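(* Consider problem (P) and the RPDC method as defined in the context, under the assumptions on (P), $K$, $\epsilon$, $\rho$ listed there. For a given saddle point $w^*=(u^*,p^* )$ of the Lagrangian $L$, if the KKT mapping $H(w)$ is global strong metric subregular at $w^*$ for $0$, then there exists $\alpha\in(0,1)$ such that the sequence $\{w^k\}$ generated by RPDC satisfies $$\mathbb{E}_{\mathcal{F}_{k+1}}\phi(w^{k+1},w^* )\le\alpha^{k+1}\phi(w^0,w^* )\qquad\text{for all }k,$$ where $\mathbb{E}_{\mathcal{F}_{k+1}}$ is the expectation over the random indices generated by the method.
   Context: Problem (P): minimize $F(u)=G(u)+J(u)$ subject to $Au-b=0$, $u\in\mathbf{U}$, where $\mathbf{U}=\mathbf{U}_1\times\cdots\times\mathbf{U}_N\subset\mathbb{R}^n$ is closed and convex, $\mathbf{U}_i\subset\mathbb{R}^{n_i}$, $\sum_i n_i=n$; $A=(A_1,\dots,A_N)\in\mathbb{R}^{m\times n}$ with $A_i\in\mathbb{R}^{m\times n_i}$, $b\in\mathbb{R}^m$; $J(u)=\sum_{i=1}^N J_i(u_i)$ with each $J_i$ a convex, possibly non-smooth function on $\mathbf{U}_i$. Assumptions on (P): $J$ is a convex, lower semi-continuous function (not necessarily differentiable) such that $\mathbf{dom}\,J\cap\mathbf{U}\neq\emptyset$; $G$ is convex and differentiable and its derivative is Lipschitz with constant $B_G$; the Lagrangian $L(u,p)=F(u)+\langle p,Au-b\rangle$ has at least one saddle point, i.e. a point $(u^*,p^* )\in\mathbf{U}\times\mathbb{R}^m$ with $L(u^*,p)\le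 L(u^*,p^* )\le L(u,p^* )$ for all $u\in\mathbf{U}$, $p\in\mathbb{R}^m$. Core function and parameters: $K$ is strongly convex with parameter $\beta$ and differentiable, with gradient Lipschitz continuous with parameter $B$ on $\mathbf{U}$; $D(u,v)=K(u)-K(v)-\langle\nabla K(v),u-v\rangle$. The parameters $\gamma$, $\epsilon$, $\rho$ satisfy $0<\epsilon<\beta/[B_G+\gamma\lambda_{\max}(A^\top A)]$ and $0<\rho<\frac{2\gamma}{2N-1}$ (so $\gamma>0$), with $\lambda_{\max}(A^\top A)$ the largest eigenvalue of $A^\top A$. RPDC method: from an initial point $u^0\in\mathbf{U}$, $p^0\in\mathbb{R}^m$, for $k=0,1,2,\dots$: choose $i(k)$ from $\{1,\dots,N\}$ with equal probability; with $q^k=p^k+\gamma(Au^k-b)$ set $$u^{k+1}=\arg\min_{u\in\mathbf{U}}\ \langle\nabla_{i(k)}G(u^k),u_{i(k)}\rangle+J_{i(k)}(u_{i(k)})+\langle q^k,A_{i(k)}u_{i(k)}\rangle+\tfrac1\epsilon D(u,u^k),\qquad p^{k+1}=p^k+\rho(Au^{k+1}-b),$$ and $w^k=(u^k,p^k)$. For $w=(u,p)\in\mathbf{U}\times\mathbb{R}^m$ and the saddle point $w^*$, $$\Lambda(w,w^* )=D(u^*,u)+\frac{\epsilon}{2N\rho}\|p-p^*\|^2+\frac{\epsilon(N-1)}{N}[L(u,p)-L(u^*,p^* )]+\frac{\epsilon(N-2)\gamma}{2N}\|Au-b\|^2,$$ $$\phi(w,w^* )=\Lambda(w,w^* )+\frac{\epsilon}{N}[L(u,p^*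 )-L(u^*,p^* )].$$ KKT mapping $H:\mathbb{R}^n\times\mathbb{R}^m\rightrightarrows\mathbb{R}^n\times\mathbb{R}^m$: $$H(w)=\begin{pmatrix}\nabla G(u)+\partial J(u)+A^\top p+\mathcal{N}_{\mathbf{U}}(u)\\ b-Au\end{pmatrix},$$ with $\mathcal{N}_{\mathbf{U}}(u)=\{\xi:\langle\xi,\zeta-u\rangle\le0\ \forall\zeta\in\mathbf{U}\}$ the normal cone at $u$ to $\mathbf{U}$ (by the usual convention, empty for $u\notin\mathbf{U}$); the saddle point problem of (P) is represented as the inclusion $0\in H(w)$. Global strong metric subregularity: a set-valued mapping $\mathcal{H}$ between real spaces $\mathbf{X}$ and $\mathbf{Y}$ is global strong metric subregular at $\bar x$ for $\bar y$, where $\bar y\in\mathcal{H}(\bar x)$, if there is a positive number $\mathfrak{c}$ with $\mathrm{dist}(x,\bar x)\le\mathfrak{c}\,\mathrm{dist}(\bar y,\mathcal{H}(x))$ for all $x\in\mathbf{X}$ (by the usual convention, $\mathrm{dist}(\bar y,\emptyset)=+\infty$).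
   Formalization: The RPDC step is additionally required to change only block i(k) of u (automatic if K is a sum of block functions); without this the claim fails for some non-separable K. Each J_i is taken as a function on U_i, equal to +∞ outside it. *)

(* Defs.v *)
From HB Require Import structures.
From mathcomp Require Import all_boot all_order all_algebra.
From mathcomp Require Import all_classical all_reals all_analysis.
Set Implicit Arguments.
Unset Strict Implicit.
Unset Printing Implicit Defensive.
Import Order.TTheory GRing.Theory Num.Theory.
Import numFieldNormedType.Exports.
Local Open Scope classical_set_scope.
Local Open Scope ring_scope.

(* The norm `|x| of the normedModType 'cV[R]_n is the sup norm; the Euclidean
   norm has to be introduced separately (the topologies agree). *)
Definition dotv (R : realType) (n : nat) (x y : 'cV[R]_n) : R :=
  \sum_(i < n) x i ord0 * y i ord0.

Definition enorm (R : realType) (n : nat) (x : 'cV[R]_n) : R :=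
  Num.sqrt (dotv x x).

Definition grad (R : realType) (n : nat) (f : 'cV[R]_n -> R) (x : 'cV[R]_n) :
    'cV[R]_n :=
  \col_i ('d (f : 'cV[R]_n -> R^o) x (delta_mx i ord0)).

Definition grad_lipschitz_on (R : realType) (n : nat) (C : set 'cV[R]_n) (L : R)
    (f : 'cV[R]_n -> R) : Prop :=
  forall x y, C x -> C y -> enorm (grad f x - grad f y) <= L * enorm (x - y).

Definition differentiable_on (R : realType) (n : nat) (C : set 'cV[R]_n)
    (f : 'cV[R]_n -> R) : Prop :=
  forall x, C x -> differentiable (f : 'cV[R]_n -> R^o) x.

Definition strongly_convex_on (R : realType) (n : nat) (C : set 'cV[R]_n)
    (beta : R) (f : 'cV[R]_n -> R) : Prop :=
  0 < beta /\
  forall (x y : 'cV[R]_n) (t : R), C x -> C y -> 0 <= t <= 1 ->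
    f (t *: x + (1 - t) *: y) <=
      t * f x + (1 - t) * f y - beta / 2 * (t * (1 - t)) * enorm (x - y) ^+ 2.

(* The library's convex_function only covers real-valued functions.  For
   functions with values in ]-oo, +oo] the convention 0 * +oo = 0 makes the
   cases t = 0 and t = 1 trivial. *)
Definition econvex (R : realType) (n : nat) (f : 'cV[R]_n -> \bar R) : Prop :=
  forall (x y : 'cV[R]_n) (t : R), 0 <= t <= 1 ->
    (f (t *: x + (1 - t) *: y)%R <= t%:E * f x + (1 - t)%:E * f y)%E.

Definition edom (R : realType) (n : nat) (f : 'cV[R]_n -> \bar R) :
    set 'cV[R]_n := [set x | (f x < +oo)%E].

Definition subdiff (R : realType) (n : nat) (f : 'cV[R]_n -> \bar R)
    (x : 'cV[R]_n) : set 'cV[R]_n :=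
  [set xi | f x \is a fin_num /\
            forall y, (f x + (dotv xi (y - x))%:E <= f y)%E].

Definition normal_cone (R : realType) (n : nat) (C : set 'cV[R]_n)
    (x : 'cV[R]_n) : set 'cV[R]_n :=
  [set xi | C x /\ forall z, C z -> dotv xi (z - x) <= 0].

Definition largest_eigenvalue (R : realType) (n : nat) (M : 'M[R]_n) (l : R) :
    Prop :=
  eigenvalue M l /\ forall l', eigenvalue M l' -> l' <= l.

Definition is_argmin (R : realType) (T : Type) (C : set T) (f : T -> \bar R)
    (x : T) : Prop :=
  C x /\ forall y, C y -> (f x <= f y)%E.

(* Vectors of R^(n_1 + ... + n_N) are columns indexed by \sum_i n_ i; the block
   u_i is submxcol u i and the column block A_i is submxrow A i. *)
Definition prodset (R : realType) (N : nat) (n_ : 'I_N -> nat)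
    (U_ : forall i, set 'cV[R]_(n_ i)) : set 'cV[R]_(\sum_(i < N) n_ i)%N :=
  [set u | forall i, U_ i (submxcol u i)].

(* J_i is a function on U_i only.  As usual it is extended by +oo outside U_i,
   so that it can be treated as a function on the whole space. *)
Definition block_ext (R : realType) (N : nat) (n_ : 'I_N -> nat)
    (U_ : forall i, set 'cV[R]_(n_ i)) (J_ : forall i, 'cV[R]_(n_ i) -> \bar R)
    (i : 'I_N) : 'cV[R]_(n_ i) -> \bar R :=
  patch (fun=> +oo%E) (U_ i) (J_ i).

Definition sepJ (R : realType) (N : nat) (n_ : 'I_N -> nat)
    (U_ : forall i, set 'cV[R]_(n_ i)) (J_ : forall i, 'cV[R]_(n_ i) -> \bar R)
    (u : 'cV[R]_(\sum_(i < N) n_ i)%N) : \bar R :=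
  (\sum_(i < N) block_ext U_ J_ (submxcol u i))%E.

Definition lagrangian (R : realType) (n m : nat) (G : 'cV[R]_n -> R)
    (J : 'cV[R]_n -> \bar R) (A : 'M[R]_(m, n)) (b : 'cV[R]_m)
    (u : 'cV[R]_n) (p : 'cV[R]_m) : \bar R :=
  ((G u)%:E + J u + (dotv p (A *m u - b))%:E)%E.

Definition saddle_point (R : realType) (n m : nat) (U : set 'cV[R]_n)
    (L : 'cV[R]_n -> 'cV[R]_m -> \bar R) (w : 'cV[R]_n * 'cV[R]_m) : Prop :=
  U w.1 /\
  forall u p, U u -> (L w.1 p <= L w.1 w.2)%E /\ (L w.1 w.2 <= L u w.2)%E.

Definition bregman (R : realType) (n : nat) (K : 'cV[R]_n -> R)
    (u v : 'cV[R]_n) : R :=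
  K u - K v - dotv (grad K v) (u - v).

Definition Lambda (R : realType) (N n m : nat) (G : 'cV[R]_n -> R)
    (J : 'cV[R]_n -> \bar R) (A : 'M[R]_(m, n)) (b : 'cV[R]_m)
    (K : 'cV[R]_n -> R) (gamma eps rho : R)
    (w ws : 'cV[R]_n * 'cV[R]_m) : \bar R :=
  let L := lagrangian G J A b in
  ((bregman K ws.1 w.1)%:E
   + (eps / (2 * N%:R * rho) * enorm (w.2 - ws.2) ^+ 2)%:E
   + (eps * (N%:R - 1) / N%:R)%:E * (L w.1 w.2 - L ws.1 ws.2)
   + (eps * (N%:R - 2) * gamma / (2 * N%:R) * enorm (A *m w.1 - b) ^+ 2)%:E)%E.

Definition phi (R : realType) (N n m : nat) (G : 'cV[R]_n -> R)
    (J : 'cV[R]_n -> \bar R) (A : 'M[R]_(m, n)) (b : 'cV[R]_m)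
    (K : 'cV[R]_n -> R) (gamma eps rho : R)
    (w ws : 'cV[R]_n * 'cV[R]_m) : \bar R :=
  let L := lagrangian G J A b in
  (Lambda N G J A b K gamma eps rho w ws
   + (eps / N%:R)%:E * (L w.1 ws.2 - L ws.1 ws.2))%E.

Definition KKT (R : realType) (n m : nat) (U : set 'cV[R]_n)
    (G : 'cV[R]_n -> R) (J : 'cV[R]_n -> \bar R) (A : 'M[R]_(m, n))
    (b : 'cV[R]_m) (w : 'cV[R]_n * 'cV[R]_m) : set ('cV[R]_n * 'cV[R]_m) :=
  [set h | (exists xi zeta, [/\ subdiff J w.1 xi, normal_cone U w.1 zeta &
              h.1 = grad G w.1 + xi + A^T *m w.2 + zeta]) /\
           h.2 = b - A *m w.1].

Definition edist (R : realType) (n m : nat) (x y : 'cV[R]_n * 'cV[R]_m) : R :=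
  Num.sqrt (enorm (x.1 - y.1) ^+ 2 + enorm (x.2 - y.2) ^+ 2).

(* ereal_inf set0 = +oo *)
Definition edist_set (R : realType) (n m : nat) (x : 'cV[R]_n * 'cV[R]_m)
    (S : set ('cV[R]_n * 'cV[R]_m)) : \bar R :=
  ereal_inf [set (edist x s)%:E | s in S].

Definition global_strong_metric_subregular (R : realType) (n m n' m' : nat)
    (H : 'cV[R]_n * 'cV[R]_m -> set ('cV[R]_n' * 'cV[R]_m'))
    (xbar : 'cV[R]_n * 'cV[R]_m) (ybar : 'cV[R]_n' * 'cV[R]_m') : Prop :=
  H xbar ybar /\
  exists2 c : R, 0 < c &
    forall x, ((edist x xbar)%:E <= c%:E * edist_set ybar (H x))%E.

Definition independent_indices (R : realType) (d : measure_display)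
    (Omega : measurableType d) (P : probability Omega R) (N : nat)
    (i_ : nat -> Omega -> 'I_N) : Prop :=
  forall (s : seq nat) (B : nat -> set 'I_N), uniq s ->
    P (\bigcap_(t in [set` s]) (i_ t @^-1` B t)) =
    (\prod_(t <- s) P (i_ t @^-1` B t))%E.

Definition uniform_indices (R : realType) (d : measure_display)
    (Omega : measurableType d) (P : probability Omega R) (N : nat)
    (i_ : nat -> Omega -> 'I_N) : Prop :=
  forall t j, measurable (i_ t @^-1` [set j]) /\
              P (i_ t @^-1` [set j]) = (N%:R^-1)%:E.

Definition RPDC_objective (R : realType) (N m : nat) (n_ : 'I_N -> nat)
    (U_ : forall i, set 'cV[R]_(n_ i)) (J_ : forall i, 'cV[R]_(n_ i) -> \bar R)
    (G : 'cV[R]_(\sum_(i < N) n_ i)%N -> R)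
    (A : 'M[R]_(m, (\sum_(i < N) n_ i)%N)) (b : 'cV[R]_m)
    (K : 'cV[R]_(\sum_(i < N) n_ i)%N -> R) (gamma eps : R) (i : 'I_N)
    (w : 'cV[R]_(\sum_(i < N) n_ i)%N * 'cV[R]_m)
    (u : 'cV[R]_(\sum_(i < N) n_ i)%N) : \bar R :=
  let q := w.2 + gamma *: (A *m w.1 - b) in
  ((dotv (submxcol (grad G w.1) i) (submxcol u i))%:E
   + block_ext U_ J_ (submxcol u i)
   + (dotv q (submxrow A i *m submxcol u i))%:E
   + (eps^-1 * bregman K u w.1)%:E)%E.

(* One iteration from w to w' with selected index i.  The clause on the blocks
   j != i says that this is a coordinate method: only block i is updated.  When
   K u = \sum_i K_i (submxcol u i) it follows from the minimality clause, since
   the objective depends on the other blocks only through the Bregman term. *)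
Definition RPDC_step (R : realType) (N m : nat) (n_ : 'I_N -> nat)
    (U_ : forall i, set 'cV[R]_(n_ i)) (J_ : forall i, 'cV[R]_(n_ i) -> \bar R)
    (G : 'cV[R]_(\sum_(i < N) n_ i)%N -> R)
    (A : 'M[R]_(m, (\sum_(i < N) n_ i)%N)) (b : 'cV[R]_m)
    (K : 'cV[R]_(\sum_(i < N) n_ i)%N -> R) (gamma eps rho : R) (i : 'I_N)
    (w w' : 'cV[R]_(\sum_(i < N) n_ i)%N * 'cV[R]_m) : Prop :=
  [/\ is_argmin (prodset U_) (RPDC_objective U_ J_ G A b K gamma eps i w) w'.1,
      forall j, j != i -> submxcol w'.1 j = submxcol w.1 j
    & w'.2 = w.2 + rho *: (A *m w'.1 - b)].

Definition RPDC_sequence (R : realType) (N m : nat) (n_ : 'I_N -> nat)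
    (U_ : forall i, set 'cV[R]_(n_ i)) (J_ : forall i, 'cV[R]_(n_ i) -> \bar R)
    (G : 'cV[R]_(\sum_(i < N) n_ i)%N -> R)
    (A : 'M[R]_(m, (\sum_(i < N) n_ i)%N)) (b : 'cV[R]_m)
    (K : 'cV[R]_(\sum_(i < N) n_ i)%N -> R) (gamma eps rho : R)
    (d : measure_display) (Omega : measurableType d) (P : probability Omega R)
    (i_ : nat -> Omega -> 'I_N)
    (w0 : 'cV[R]_(\sum_(i < N) n_ i)%N * 'cV[R]_m)
    (w : nat -> Omega -> 'cV[R]_(\sum_(i < N) n_ i)%N * 'cV[R]_m) : Prop :=
  [/\ uniform_indices P i_, independent_indices P i_, prodset U_ w0.1,
      forall omega, w 0%N omega = w0
    & forall k omega,
        RPDC_step U_ J_ G A b K gamma eps rho (i_ k omega)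
          (w k omega) (w k.+1 omega)].

(* Main.v *)
Require Import Defs.
From HB Require Import structures.
From mathcomp Require Import all_boot all_order all_algebra.
From mathcomp Require Import all_classical all_reals all_analysis.
From mathcomp Require Import ring lra.
Set Implicit Arguments.
Unset Strict Implicit.
Unset Printing Implicit Defensive.
Import Order.TTheory GRing.Theory Num.Theory.
Import numFieldNormedType.Exports.
Local Open Scope classical_set_scope.
Local Open Scope ring_scope.

(** The first-order condition of the i-th block problem, tested at the primal
    solution us, bounds D(us, u') for the next iterate u'.  Combined with the
    descent lemma for G and the multiplier update this bounds phi(w') for each
    drawn index i.  Summing over i, with w_i = (u_i, p_i) the successor of
    w = (u, p) for the index i, leaves
      sum_i phi(w_i) <= N phi(w) - eps (L(u, ps) - L(us, ps))
                        - c1 sum_i |u_i - u|^2 - c2 sum_i |A u_i - b|^2.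
    The point built from the i-th block of every u_i, together with the dual
    vector q = p + gamma (A u - b), has a KKT residual controlled by the last
    two sums, so subregularity bounds the distance from w to ws, and hence
    phi(w), by the quantities that are subtracted: phi contracts in mean over
    one step.  The iterates are determined by the drawn indices, so the
    expectation is a finite average over index sequences and the one-step
    contraction can be iterated. *)

(** * The Euclidean inner product *)

Section InnerProduct.
Context {R : realType} {n : nat}.
Implicit Types (x y z : 'cV[R]_n) (t : R).

Lemma dotvC x y : dotv x y = dotv y x.
Proof. by apply: eq_bigr => i _; rewrite mulrC. Qed.

Lemma dotvDl x y z : dotv (x + y) z = dotv x z + dotv y z.
Proof. by rewrite -big_split; apply: eq_bigr => i _; rewrite mxE mulrDl. Qed.

Lemma dotvZl t x y : dotv (t *: x) y = t * dotv x y.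
Proof. by rewrite mulr_sumr; apply: eq_bigr => i _; rewrite mxE mulrA. Qed.

Lemma dotvNl x y : dotv (- x) y = - dotv x y.
Proof. by rewrite -scaleN1r dotvZl mulN1r. Qed.

Lemma dotvBl x y z : dotv (x - y) z = dotv x z - dotv y z.
Proof. by rewrite dotvDl dotvNl. Qed.

Lemma dotvDr x y z : dotv x (y + z) = dotv x y + dotv x z.
Proof. by rewrite dotvC dotvDl !(dotvC x). Qed.

Lemma dotvZr t x y : dotv x (t *: y) = t * dotv x y.
Proof. by rewrite dotvC dotvZl dotvC. Qed.

Lemma dotvNr x y : dotv x (- y) = - dotv x y.
Proof. by rewrite dotvC dotvNl dotvC. Qed.

Lemma dotvBr x y z : dotv x (y - z) = dotv x y - dotv x z.
Proof. by rewrite dotvDr dotvNr. Qed.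

Lemma dotv0l x : dotv 0 x = 0.
Proof. by rewrite -(scale0r 0) dotvZl mul0r. Qed.

Lemma dotv0r x : dotv x 0 = 0.
Proof. by rewrite dotvC dotv0l. Qed.

Lemma dotv_ge0 x : 0 <= dotv x x.
Proof. by apply: sumr_ge0 => i _; rewrite -expr2 sqr_ge0. Qed.

Lemma dotv_eq0 x : dotv x x = 0 -> x = 0.
Proof.
move/psumr_eq0P => h; apply/matrixP => i j; rewrite ord1 mxE.
apply/eqP; rewrite -sqrf_eq0 expr2; apply/eqP; apply: h => // k _.
by rewrite -expr2 sqr_ge0.
Qed.

Lemma enorm_ge0 x : 0 <= enorm x.
Proof. exact: sqrtr_ge0. Qed.

Lemma enorm_sqr x : enorm x ^+ 2 = dotv x x.
Proof. by rewrite sqr_sqrtr ?dotv_ge0. Qed.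

Lemma dotvE x y : dotv x y = (x^T *m y) 0 0.
Proof. by rewrite mxE; apply: eq_bigr => i _; rewrite mxE. Qed.

Lemma dotv_sqrD x y : dotv (x + y) (x + y) <= 2 * dotv x x + 2 * dotv y y.
Proof.
have := dotv_ge0 (x - y).
by rewrite !(dotvBl, dotvBr, dotvDl, dotvDr) (dotvC y x); lra.
Qed.

End InnerProduct.

(** * Cauchy-Schwarz inequalities and the spectral bound on [A] *)

Lemma dotv_mulmx {R : realType} {m n : nat} (A : 'M[R]_(m, n)) x y :
  dotv x (A *m y) = dotv (A^T *m x) y.
Proof. by rewrite !dotvE trmx_mul trmxK mulmxA. Qed.

(** No sign of [a] is assumed. For [a > 0] the vertex [- b / a] gives the bound; for [a <= 0] a
    point where the polynomial is negative is exhibited unless [a = b = 0]. *)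
Lemma discriminant_le0 (R : realFieldType) (a b c : R) :
  (forall t, 0 <= a * t ^+ 2 + 2 * b * t + c) -> b ^+ 2 <= a * c.
Proof.
move=> h.
have [a0|a0] := ltP 0 a.
  have := h (- b / a).
  have -> : a * (- b / a) ^+ 2 + 2 * b * (- b / a) + c = (a * c - b ^+ 2) / a.
    by field; rewrite gt_eqF.
  by rewrite pmulr_lge0 ?invr_gt0// subr_ge0.
have c0 : 0 <= c by have := h 0; lra.
have [e0|b0] := eqVneq b 0.
  rewrite {}e0 in h *.
  have [->|an0] := eqVneq a 0; first by rewrite mul0r expr0n.
  have al : a < 0 by rewrite lt_neqAle an0.
  have := h ((c + 1) / - a + 1).
  rewrite mulr0 mul0r addr0.
  set s := (c + 1) / - a => hs.
  have s0 : 0 <= s by apply: divr_ge0; lra.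
  have e : a * s = - (c + 1) by rewrite /s; field.
  have e2 : a * s ^+ 2 = - (c + 1) * s by rewrite expr2 mulrA e.
  by exfalso; move: hs; rewrite sqrrD expr1n mulr1 !mulrDr mulr1 e2; nra.
have := h (- (c + 1) / (2 * b)).
have -> : 2 * b * (- (c + 1) / (2 * b)) = - (c + 1) by field.
set s := _ ^+ 2 => hs; have s0 : 0 <= s by exact: sqr_ge0.
by exfalso; nra.
Qed.

(** The form of [S] at [x + t *: y] is a nonnegative quadratic polynomial in [t], and the claim
    concerns its discriminant. [S = 1] gives the usual inequality; the Rayleigh bound needs a
    general [S]. *)
Lemma psd_cauchy_schwarz (R : realType) n (S : 'M[R]_n) (x y : 'cV[R]_n) :
  S^T = S -> (forall z, 0 <= dotv (S *m z) z) ->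
  dotv (S *m x) y ^+ 2 <= dotv (S *m x) x * dotv (S *m y) y.
Proof.
move=> sS pS; rewrite mulrC; apply: discriminant_le0 => t.
have := pS (x + t *: y).
rewrite mulmxDr -scalemxAr !(dotvDl, dotvDr, dotvZl, dotvZr).
rewrite -[S in dotv (S *m y) x]sS -dotv_mulmx (dotvC y).
by move=> h; apply: le_trans h _; rewrite le_eqVlt; apply/orP; left; apply/eqP; ring.
Qed.

Lemma dotv_cauchy_schwarz (R : realType) n (x y : 'cV[R]_n) :
  dotv x y <= enorm x * enorm y.
Proof.
have h : dotv x y ^+ 2 <= dotv x x * dotv y y.
  have := @psd_cauchy_schwarz R n 1%:M x y (trmx1 _ _).
  rewrite !mul1mx; apply => z; rewrite mul1mx; exact: dotv_ge0.
apply: (le_trans (ler_norm _)).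
rewrite -sqrtr_sqr -sqrtrM ?dotv_ge0// ler_wsqrtr//.
Qed.

(** Cauchy-Schwarz on each row; the added 1 keeps the constant positive when [A = 0]. *)
Lemma mulmx_bounded (R : realType) m n (A : 'M[R]_(m, n)) :
  exists2 C, 0 < C & forall x, dotv (A *m x) (A *m x) <= C * dotv x x.
Proof.
exists (1 + \sum_i dotv (row i A)^T (row i A)^T) => [|x].
  by apply: ltr_pwDl => //; apply: sumr_ge0 => i _; exact: dotv_ge0.
rewrite mulrDl mul1r [leLHS]/dotv.
apply: (@le_trans _ _ (\sum_i dotv (row i A)^T (row i A)^T * dotv x x)).
  apply: ler_sum => i _; rewrite -!expr2.
  have -> : (A *m x) i ord0 = dotv (row i A)^T x.
    by rewrite mxE; apply: eq_bigr => j _; rewrite !mxE.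
  have := @psd_cauchy_schwarz R n 1%:M (row i A)^T x (trmx1 _ _).
  by rewrite !mul1mx; apply => z; rewrite mul1mx; exact: dotv_ge0.
by rewrite -mulr_suml lerDr dotv_ge0.
Qed.

(* The infimum mu of the upper bounds of the Rayleigh quotient is an eigenvalue:
   otherwise S = mu - M would be positive semidefinite and invertible, hence
   bounded below by a positive multiple of the identity. *)
Lemma rayleigh_le (R : realType) m n (A : 'M[R]_(m, n)) (lam : R) :
  largest_eigenvalue (A^T *m A) lam ->
  forall x, dotv (A *m x) (A *m x) <= lam * dotv x x.
Proof.
move=> [/eigenvalueP[v ev v0] lmax].
set M := A^T *m A in ev lmax.
have symM : M^T = M by rewrite trmx_mul trmxK.
have quadM x : dotv (A *m x) (A *m x) = dotv (M *m x) x.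
  by rewrite dotv_mulmx mulmxA.
pose T := [set t | forall x, dotv (M *m x) x <= t * dotv x x].
have nT : T !=set0.
  by have [C _ hC] := mulmx_bounded A; exists C => x; rewrite -quadM.
have vv : 0 < dotv v^T v^T.
  rewrite lt_neqAle dotv_ge0 andbT eq_sym; apply/eqP => /dotv_eq0/eqP.
  by rewrite trmx_eq0 (negbTE v0).
have lbT : lbound T lam.
  move=> t /(_ v^T).
  have -> : M *m v^T = lam *: v^T by rewrite -[M]symM -trmx_mul ev linearZ.
  by rewrite dotvZl ler_pM2r.
have hiT : has_inf T by split => //; exists lam.
set mu := inf T.
have Tmu : T mu.
  move=> x; have [->|x0] := eqVneq x 0; first by rewrite mulmx0 !dotv0r mulr0.
  have xx : 0 < dotv x x.
    rewrite lt_neqAle dotv_ge0 andbT eq_sym; apply/eqP => /dotv_eq0/eqP.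
    by rewrite (negbTE x0).
  rewrite -ler_pdivrMr//; apply: lb_le_inf => // t /(_ x).
  by rewrite ler_pdivrMr.
suff emu : eigenvalue M mu.
  move=> x; rewrite quadM; apply: (le_trans (Tmu x)).
  by rewrite ler_wpM2r ?dotv_ge0// lmax.
apply: contraT => nemu.
pose S := mu%:M - M.
have uS : S \in unitmx.
  rewrite -row_free_unit -kermx_eq0; apply: contraNT nemu => kn0.
  rewrite /eigenvalue /eigenspace; apply: contraNN kn0 => /eqP k0.
  have -> : S = - (M - mu%:M) by rewrite opprB.
  apply/eqP/row_matrixP => i; rewrite row0.
  have : (row i (kermx (- (M - mu%:M))) <= kermx (M - mu%:M))%MS.
    apply/sub_kermxP; have := row_sub i (kermx (- (M - mu%:M))).
    by move/sub_kermxP; rewrite mulmxN => /eqP; rewrite oppr_eq0 => /eqP.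
  by rewrite k0 submx0 => /eqP.
have symS : S^T = S by rewrite linearB /= tr_scalar_mx symM.
have quadS x : dotv (S *m x) x = mu * dotv x x - dotv (M *m x) x.
  by rewrite mulmxBl dotvBl mul_scalar_mx dotvZl.
have psdS x : 0 <= dotv (S *m x) x by rewrite quadS subr_ge0; exact: Tmu.
have [C C0 hC] := mulmx_bounded (invmx S).
(* Expanding [0 <= |S^-1 x - x|^2] bounds the form of [S^-1] by a multiple of the identity. *)
have hS x : dotv (invmx S *m x) x <= (C + 1) / 2 * dotv x x.
  have := dotv_ge0 (invmx S *m x - x); have := hC x.
  by rewrite !(dotvBl, dotvBr) (dotvC x (_ *m _)); lra.
have D0 : 0 < (C + 1) / 2 by lra.
have : T (mu - ((C + 1) / 2)^-1).
  move=> x; have [->|x0] := eqVneq x 0; first by rewrite mulmx0 !dotv0r mulr0.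
  have xx : 0 < dotv x x.
    rewrite lt_neqAle dotv_ge0 andbT eq_sym; apply/eqP => /dotv_eq0/eqP.
    by rewrite (negbTE x0).
  (* Here Cauchy-Schwarz reads [|x|^4 <= <S x, x> <S^-1 x, x>], so [S] dominates a positive multiple
     of the identity and [mu] can be lowered within [T]. *)
  have := psd_cauchy_schwarz x (invmx S *m x) symS psdS.
  rewrite -[S in dotv (S *m x) (_ *m _)]symS -dotv_mulmx mulmxA mulmxV// mul1mx.
  have Sx := psdS x; have h2 := hS x.
  rewrite (dotvC x (_ *m _)) => h.
  rewrite mulrBl lerBrDr -lerBrDl -quadS.
  rewrite ler_pdivrMl//.
  rewrite -(ler_pM2l xx) -expr2; apply: (le_trans h).
  rewrite [leRHS]mulrCA [leRHS]mulrC.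
  apply: (le_trans (ler_wpM2l Sx h2)); rewrite le_eqVlt; apply/orP; left; apply/eqP.
  by ring.
move=> /(ge_inf hiT.2); rewrite -/mu lerBrDr gerDl leNgt invr_gt0 D0 //.
Qed.

(** * Directional derivatives and first-order conditions *)

Lemma diff_dotv_grad (R : realType) n (f : 'cV[R]_n -> R) x d :
  'd (f : 'cV[R]_n -> R^o) x d = dotv (grad f x) d.
Proof.
rewrite [in LHS](matrix_sum_delta d) linear_sum; apply: eq_bigr => i _.
by rewrite big_ord1 linearZ mxE mulrC.
Qed.

Lemma directional_approx (R : realType) n (f : 'cV[R]_n -> R) x d (e : R) :
  differentiable (f : 'cV[R]_n -> R^o) x -> 0 < e ->
  exists2 t0, 0 < t0 & forall t, 0 < t < t0 ->
    `|f (x + t *: d) - f x - t * dotv (grad f x) d| <= t * e.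
Proof.
move=> df e0; have dd : derivable (f : 'cV[R]_n -> R^o) x d.
  exact: diff_derivable.
have := dd; rewrite /derivable => /cvgP.
have : (fun h => h^-1 *: ((f (h *: d + x) : R^o) - f x)) @ 0^' -->
    'D_d (f : 'cV[R]_n -> R^o) x by exact: dd.
rewrite deriveE// diff_dotv_grad => /cvgrPdist_le/(_ _ e0) /nbhs_ballP[t0 /= t00 h] _.
exists t0 => // t /andP[tp tt0].
have /= := h t; rewrite /ball /= sub0r normrN gtr0_norm// => /(_ tt0).
rewrite gt_eqF// => /(_ isT).
rewrite distrC (addrC (t *: d)) => {}h.
rewrite -ler_pdivrMl// -[t^-1]gtr0_norm ?invr_gt0// -normrM.
by rewrite mulrBr mulKf ?gt_eqF.
Qed.

Lemma directional_approx_small (R : realType) n (f : 'cV[R]_n -> R) x d (e z : R) :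
  differentiable (f : 'cV[R]_n -> R^o) x -> 0 < z ->
  exists t, [/\ 0 < t <= 1, t * e <= z &
    `|f (x + t *: d) - f x - t * dotv (grad f x) d| <= t * z].
Proof.
move=> df z0; have [t0 t00 H] := directional_approx d df z0.
have e1 : 0 < `|e| + 1 by rewrite ltr_wpDl.
(* [e] may have any sign or vanish, hence the denominator [|e| + 1]; halving [t0] yields the strict
   inequality [t < t0]. *)
pose t := Num.min (Num.min 1 (t0 / 2)) (z / (`|e| + 1)).
have tp : 0 < t by rewrite !lt_min ltr01 !divr_gt0.
exists t; split; first by rewrite tp !ge_min lexx.
  apply: (@le_trans _ _ (t * (`|e| + 1))).
    by rewrite (ler_wpM2l (ltW tp))// ler_wpDr// ler_norm.
  by rewrite -ler_pdivlMr// !ge_min lexx !orbT.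
apply: H; rewrite tp /=.
by apply: (@le_lt_trans _ _ (t0 / 2)); [rewrite !ge_min lexx orbT|lra].
Qed.

(** Divide by [t] and let [t] tend to 0: the quadratic term disappears. *)
Lemma first_order_ge (R : realType) n (f : 'cV[R]_n -> R) x d (c e : R) :
  differentiable (f : 'cV[R]_n -> R^o) x ->
  (forall t, 0 < t <= 1 -> t * c - t ^+ 2 * e <= f (x + t *: d) - f x) ->
  c <= dotv (grad f x) d.
Proof.
move=> df h; apply/ler_addgt0Pr => z z0.
have z2 : 0 < z / 2 by lra.
have [t [t01 te]] := directional_approx_small d e df z2.
have /andP[tp _] := t01; rewrite ler_norml => /andP[_ h1].
have h2 := h t t01; rewrite -(ler_pM2l tp).
have : t * (t * e) <= t * (z / 2) by rewrite ler_pM2l.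
by move: h1 h2; rewrite expr2; lra.
Qed.

Lemma first_order_le (R : realType) n (f : 'cV[R]_n -> R) x d (c e : R) :
  differentiable (f : 'cV[R]_n -> R^o) x ->
  (forall t, 0 < t <= 1 -> f (x + t *: d) - f x <= t * c + t ^+ 2 * e) ->
  dotv (grad f x) d <= c.
Proof.
move=> df h; apply/ler_addgt0Pr => z z0.
have z2 : 0 < z / 2 by lra.
have [t [t01 te]] := directional_approx_small d e df z2.
have /andP[tp _] := t01; rewrite ler_norml => /andP[h1 _].
have h2 := h t t01; rewrite -(ler_pM2l tp).
have : t * (t * e) <= t * (z / 2) by rewrite ler_pM2l.
by move: h1 h2; rewrite expr2; lra.
Qed.

(** * Convexity, Bregman distances and the descent lemma *)

Lemma i01_of_real (R : realType) (t : R) : 0 <= t <= 1 ->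
  exists p : {i01 R}, p%:num = t.
Proof.
move=> /andP[t0 t1].
have Pt : Itv.spec (@Itv.num_sem R) (Itv.Real `[0%Z, 1%Z]) t.
  by rewrite /= /Itv.num_sem /= num_real /= in_itv /= t0 t1.
by exists (Itv.mk Pt).
Qed.

Lemma convex_function_le (R : realType) n (f : 'cV[R]_n -> R) (x y : 'cV[R]_n) t :
  convex_function setT f -> 0 <= t <= 1 ->
  f (t *: x + (1 - t) *: y) <= t * f x + (1 - t) * f y.
Proof.
move=> cf /i01_of_real[p <-]; apply: cf; exact: in_setT.
Qed.

Section StronglyConvex.
Context {R : realType} {n : nat} (U : set 'cV[R]_n) (f : 'cV[R]_n -> R) (beta : R).
Hypothesis f_diff : differentiable_on U f.
Hypothesis f_conv : forall x y t, U x -> U y -> 0 <= t <= 1 ->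
  f (t *: x + (1 - t) *: y) <=
    t * f x + (1 - t) * f y - beta / 2 * (t * (1 - t)) * dotv (x - y) (x - y).

(** Convexity along the segment from [y] to [x], to first order at [y]. The sign of [beta] is free
    here: [beta = 0] covers the merely convex [G]. *)
Lemma bregman_ge x y : U x -> U y ->
  beta / 2 * dotv (x - y) (x - y) <= bregman f x y.
Proof.
move=> Ux Uy; rewrite /bregman.
suff : dotv (grad f y) (x - y) <=
    f x - f y - beta / 2 * dotv (x - y) (x - y) by lra.
apply: (first_order_le (e := beta / 2 * dotv (x - y) (x - y))) => [|t /andP[t0 t1]].
  exact: f_diff.
have -> : y + t *: (x - y) = t *: x + (1 - t) *: y.
  by rewrite scalerBr scalerBl scale1r addrCA addrA.
have := f_conv Ux Uy (t := t); rewrite (ltW t0) t1 => /(_ isT).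
by rewrite expr2; lra.
Qed.

End StronglyConvex.

(** The Bregman distances from [x] to [y] and from [y] to [x] add up to the right-hand side. *)
Lemma bregman_le_gap (R : realType) n (f : 'cV[R]_n -> R) x y :
  0 <= bregman f y x ->
  bregman f x y <= dotv (grad f x - grad f y) (x - y).
Proof.
by rewrite /bregman; move: (grad f x) (grad f y) => gx gy; rewrite !(dotvBl, dotvBr); lra.
Qed.

Lemma grad_lipschitz_bregman (R : realType) n (U : set 'cV[R]_n) (f : 'cV[R]_n -> R) L x y :
  grad_lipschitz_on U L f -> U x -> U y -> 0 <= bregman f y x ->
  bregman f x y <= L * dotv (x - y) (x - y).
Proof.
move=> lf Ux Uy h; apply: (le_trans (bregman_le_gap h)).
apply: (le_trans (dotv_cauchy_schwarz _ _)); rewrite -enorm_sqr expr2 mulrA.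
by rewrite ler_wpM2r ?enorm_ge0//; exact: lf.
Qed.

Lemma grad_lipschitz_sqr (R : realType) n (U : set 'cV[R]_n) (f : 'cV[R]_n -> R) L x y :
  grad_lipschitz_on U L f -> U x -> U y ->
  dotv (grad f x - grad f y) (grad f x - grad f y) <= L ^+ 2 * dotv (x - y) (x - y).
Proof.
move=> lf Ux Uy; rewrite -!enorm_sqr -exprMn.
by rewrite ler_pXn2r ?nnegrE ?enorm_ge0 ?lf// (le_trans (enorm_ge0 _) (lf _ _ Ux Uy)).
Qed.

(* Halving the segment improves the constant (1 + s) L / 2 to (1 + s / 2) L / 2. *)
Lemma descent_lemma (R : realType) n (f : 'cV[R]_n -> R) L :
  (forall x y, 0 <= bregman f x y) -> grad_lipschitz_on setT L f ->
  forall x y, bregman f x y <= L / 2 * dotv (x - y) (x - y).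
Proof.
move=> cf lf.
have step k : forall x y,
    bregman f x y <= L / 2 * (1 + 2^-1 ^+ k) * dotv (x - y) (x - y).
  elim: k => [|k IH] x y.
    rewrite expr0 (_ : L / 2 * (1 + 1) = L); first exact: (@grad_lipschitz_bregman _ _ setT).
    by field.
  pose z := 2^-1 *: (x + y).
  have xz : x - z = 2^-1 *: (x - y).
    by apply/matrixP => i j; rewrite !mxE; field.
  have zy : z - y = 2^-1 *: (x - y).
    by apply/matrixP => i j; rewrite !mxE; field.
  have hg : dotv (grad f z - grad f y) (z - y) <= L * dotv (z - y) (z - y).
    apply: (le_trans (dotv_cauchy_schwarz _ _)); rewrite -enorm_sqr expr2 mulrA.
    by rewrite ler_wpM2r ?enorm_ge0//; exact: lf.
  (* Since [x - z = z - y], the distance from [x] to [y] is the sum of those from [x] to [z] and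
     from [z] to [y], plus the term bounded in [hg]. *)
  have := IH x z; have := IH z y; rewrite /bregman.
  move: hg; rewrite xz zy; move: (grad f z) (grad f y) => gz gy.
  rewrite !(dotvZl, dotvZr) (dotvBl gz) exprS; set D := dotv (x - y) (x - y).
  set s := 2^-1 ^+ k; set a := dotv gz _; set b := dotv gy _.
  have -> : 2^-1 * (2^-1 * D) = D / 4 by field.
  lra.
move=> x y; set D := dotv (x - y) (x - y); apply/ler_addgt0Pr => e e0.
have [k hk] : exists k, `|L / 2 * D| * 2^-1 ^+ k <= e.
  pose M := `|L / 2 * D|; have M0 : 0 <= M by exact: normr_ge0.
  exists (Num.bound (M / e)).
  have := Num.Theory.archi_boundP (divr_ge0 M0 (ltW e0)).
  set K := Num.bound _ => hK.
  rewrite -/M exprVn ler_pdivrMr ?exprn_gt0// mulrC -ler_pdivrMr//.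
  apply: (le_trans (ltW hK)).
  by rewrite -natrX ler_nat ltnW// ltn_expl.
apply: (le_trans (step k x y)); rewrite -/D.
have : L / 2 * D * 2^-1 ^+ k <= `|L / 2 * D| * 2^-1 ^+ k.
  by rewrite ler_wpM2r ?ler_norm// exprn_ge0// invr_ge0.
by lra.
Qed.

(** * Block decomposition of vectors *)

Section BlockProduct.
Context {R : realType} {N m : nat} {n_ : 'I_N -> nat}.
Local Notation V := 'cV[R]_(\sum_(i < N) n_ i)%N.
Implicit Types (x y z : V) (t : R) (i j : 'I_N).

(** The arguments are full vectors, which keeps the dependent block types out of most statements. *)
Definition bdotv i x y := dotv (submxcol x i) (submxcol y i).

Lemma submxcolZ t x i : submxcol (t *: x) i = t *: submxcol x i.
Proof. by apply/matrixP => j k; rewrite !mxE. Qed.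

Lemma bdotvDr i x y z : bdotv i x (y + z) = bdotv i x y + bdotv i x z.
Proof. by rewrite /bdotv submxcolD dotvDr. Qed.

Lemma bdotvZr i t x y : bdotv i x (t *: y) = t * bdotv i x y.
Proof. by rewrite /bdotv submxcolZ dotvZr. Qed.

Lemma bdotvBr i x y z : bdotv i x (y - z) = bdotv i x y - bdotv i x z.
Proof. by rewrite /bdotv submxcolB dotvBr. Qed.

Lemma bdotvDl i x y z : bdotv i (x + y) z = bdotv i x z + bdotv i y z.
Proof. by rewrite /bdotv submxcolD dotvDl. Qed.

Lemma bdotvZl i t x y : bdotv i (t *: x) y = t * bdotv i x y.
Proof. by rewrite /bdotv submxcolZ dotvZl. Qed.

Lemma dotv_blocks x y : dotv x y = \sum_i bdotv i x y.
Proof.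
rewrite dotvE -{1}[x]submxcolK -{1}[y]submxcolK tr_mxcol mul_mxrow_mxcol summxE.
by apply: eq_bigr => i _; rewrite /bdotv dotvE.
Qed.

Lemma bdotv_ge0 i x : 0 <= bdotv i x x.
Proof. exact: dotv_ge0. Qed.

Lemma bdotv_le i x : bdotv i x x <= dotv x x.
Proof.
rewrite dotv_blocks (bigD1 i)//= lerDl; apply: sumr_ge0 => j _.
exact: bdotv_ge0.
Qed.

Lemma dotv_single_block i x y : (forall j, j != i -> submxcol y j = 0) ->
  dotv x y = bdotv i x y.
Proof.
move=> y0; rewrite dotv_blocks (bigD1 i)//= big1 ?addr0// => j ji.
by rewrite /bdotv y0// dotv0r.
Qed.

Lemma dotv_submxrow (A : 'M[R]_(m, (\sum_(i < N) n_ i)%N)) q i x :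
  dotv q (submxrow A i *m submxcol x i) = bdotv i (A^T *m q) x.
Proof. by rewrite dotv_mulmx tr_submxrow submxcol_mul. Qed.

Definition replace_block i y x : V :=
  \mxcol_j (if j == i then submxcol y j else submxcol x j).

Lemma submxcol_replace i y x j :
  submxcol (replace_block i y x) j = if j == i then submxcol y j else submxcol x j.
Proof. by rewrite mxcolK. Qed.

End BlockProduct.

(** * One iteration of the method *)

Section Method.
Local Opaque grad.
Context {R : realType} {N m : nat} {n_ : 'I_N -> nat}.
Local Notation V := 'cV[R]_(\sum_(i < N) n_ i)%N.
Context (U_ : forall i, set 'cV[R]_(n_ i)) (J_ : forall i, 'cV[R]_(n_ i) -> \bar R).
Context (G K : V -> R) (A : 'M[R]_(m, (\sum_(i < N) n_ i)%N)) (b : 'cV[R]_m).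
Context (beta gamma eps rho : R).
Arguments U_ : clear implicits.
Arguments J_ : clear implicits.
Let U := prodset U_.
Let J := sepJ U_ J_.
Hypothesis Ji_proper : forall i x, U_ i x -> (-oo < J_ i x)%E.
Hypothesis Ji_convex : forall i, econvex (block_ext U_ J_ (i := i)).
Hypothesis U_convex : convex_set U.
Hypothesis K_diff : differentiable_on U K.
Hypothesis K_strong : strongly_convex_on U beta K.
Hypothesis eps_gt0 : 0 < eps.

Implicit Types (x y z u v : V) (i j : 'I_N).

Definition Jfin i x : bool := block_ext U_ J_ (submxcol x i) \is a fin_num.
(** [fine] sends infinite values to 0, so this is meaningful only under [Jfin i x]. *)
Definition Jr i x : R := fine (block_ext U_ J_ (submxcol x i)).

Lemma block_ext_gtNy i (x : 'cV_(n_ i)) : block_ext U_ J_ x != -oo%E.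
Proof.
rewrite /block_ext /patch; case: ifPn => // /set_mem /Ji_proper.
by rewrite ltNye.
Qed.

Lemma Jfin_sub i x : Jfin i x -> U_ i (submxcol x i).
Proof. by rewrite /Jfin /block_ext /patch; case: ifPn => // /set_mem. Qed.

Lemma JfinE i x : Jfin i x -> block_ext U_ J_ (submxcol x i) = (Jr i x)%:E.
Proof. by move=> h; rewrite fineK. Qed.

Lemma JfinPn i x : ~~ Jfin i x -> block_ext U_ J_ (submxcol x i) = +oo%E.
Proof.
by rewrite /Jfin; have := block_ext_gtNy (submxcol x i); case: (block_ext _ _ _).
Qed.

(** The effective domain of [J], on which the extended-real quantities become real. *)
Definition Jdom : set V := [set x | forall i, Jfin i x].

Lemma Jdom_sub x : Jdom x -> U x.
Proof. by move=> h i; exact: Jfin_sub. Qed.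

Lemma sepJE x : Jdom x -> J x = (\sum_i Jr i x)%:E.
Proof. by move=> h; rewrite -sumEFin; apply: eq_bigr => i _; rewrite JfinE. Qed.

Lemma sepJ_pinfty x : ~ Jdom x -> J x = +oo%E.
Proof.
move=> /existsNP[i /negP /JfinPn h].
apply/eqP; rewrite esum_eqy; first by apply/existsP; exists i; rewrite h eqxx.
by move=> k _; exact: block_ext_gtNy.
Qed.

Lemma sepJ_fin_num x : J x \is a fin_num -> Jdom x.
Proof. by move=> h; apply: contrapT => /sepJ_pinfty e; rewrite e in h. Qed.

Lemma Jr_convex i x y t : Jfin i x -> Jfin i y -> 0 <= t <= 1 ->
  Jfin i (t *: x + (1 - t) *: y) /\
  Jr i (t *: x + (1 - t) *: y) <= t * Jr i x + (1 - t) * Jr i y.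
Proof.
move=> fx fy t01; have := Ji_convex (submxcol x i) (submxcol y i) t01.
rewrite -!submxcolZ -submxcolD (JfinE fx) (JfinE fy) -!EFinM -EFinD => h.
have fz : Jfin i (t *: x + (1 - t) *: y).
  by apply: contraT => /JfinPn e; rewrite e in h.
by split=> //; rewrite JfinE// lee_fin in h.
Qed.

Lemma U_segment x y t : U x -> U y -> 0 <= t <= 1 -> U (t *: x + (1 - t) *: y).
Proof.
move=> Ux Uy /i01_of_real[p <-].
by have := U_convex p (mem_set Ux) (mem_set Uy) => /set_mem.
Qed.

Definition objr i (g u x : V) : R := bdotv i g x + Jr i x + eps^-1 * bregman K x u.

(** The gradient at [w.1] of the smooth part [G u + <p, A u - b> + gamma / 2 |A u - b|^2] of the
    augmented Lagrangian, with [p = w.2]; its block [i] gives the linear term of the [i]-th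
    subproblem. *)
Definition step_grad (w : V * 'cV[R]_m) : V :=
  grad G w.1 + A^T *m (w.2 + gamma *: (A *m w.1 - b)).

Lemma RPDC_objectiveE i w x : Jfin i x ->
  RPDC_objective U_ J_ G A b K gamma eps i w x = (objr i (step_grad w) w.1 x)%:E.
Proof.
move=> fx; rewrite /RPDC_objective JfinE// -!EFinD; congr EFin.
by rewrite /objr /step_grad bdotvDl -dotv_submxrow /bdotv; ring.
Qed.

Lemma RPDC_objective_pinfty i w x : ~~ Jfin i x ->
  RPDC_objective U_ J_ G A b K gamma eps i w x = +oo%E.
Proof. by move=> fx; rewrite /RPDC_objective JfinPn. Qed.

(** The point [x] has a finite objective value, which rules out a minimiser with value [+oo]. *)
Lemma step_min i w w' x : Jdom x ->
  RPDC_step U_ J_ G A b K gamma eps rho i w w' ->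
  [/\ U w'.1, Jfin i w'.1 &
    forall v, U v -> Jfin i v ->
      objr i (step_grad w) w.1 w'.1 <= objr i (step_grad w) w.1 v].
Proof.
move=> dx [[Uw' min] _ _].
have fw' : Jfin i w'.1.
  apply: contraT => /RPDC_objective_pinfty e.
  by have := min _ (Jdom_sub dx); rewrite e RPDC_objectiveE.
split=> // v Uv fv; have := min _ Uv.
by rewrite !RPDC_objectiveE// lee_fin.
Qed.

(** The minimiser is compared with points of the segment towards [v]. Convexity bounds the nonsmooth
    part linearly in [t], so only [K] has to be differentiated. *)
Lemma variational_inequality i w w' x : Jdom x ->
  RPDC_step U_ J_ G A b K gamma eps rho i w w' ->
  forall v, U v -> Jfin i v ->
  0 <= eps * (bdotv i (step_grad w) (v - w'.1) + Jr i v - Jr i w'.1)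
       + dotv (grad K w'.1 - grad K w.1) (v - w'.1).
Proof.
move=> dx hw; have [Uw' fw' min] := step_min dx hw; move=> v Uv fv.
move: (step_grad w) min => g min.
set d := v - w'.1.
suff : dotv (grad K w.1) d - eps * (bdotv i g d + Jr i v - Jr i w'.1) <=
       dotv (grad K w'.1) d.
  by move: (grad K w'.1) (grad K w.1) => g1 g2; rewrite (dotvBl g1); lra.
apply: (first_order_ge (e := 0)) => [|t /andP[t0 t1]]; first exact: K_diff.
have t01 : 0 <= t <= 1 by rewrite ltW.
have e : t *: v + (1 - t) *: w'.1 = w'.1 + t *: d.
  by rewrite scalerBr scalerBl scale1r addrCA addrA.
have [fz hz] := Jr_convex fv fw' t01.
have := min _ (U_segment Uv Uw' t01) fz; rewrite {}e in hz *.
rewrite /objr /bregman bdotvDr bdotvZr (addrAC w'.1 (t *: d)).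
rewrite (dotvDr _ (w'.1 - w.1)) dotvZr.
set p := dotv _ (w'.1 - w.1); set q := dotv _ d => h.
have : eps * (bdotv i g w'.1 + Jr i w'.1 + eps^-1 * (K w'.1 - K w.1 - p)) <=
       eps * (bdotv i g w'.1 + t * bdotv i g d + (t * Jr i v + (1 - t) * Jr i w'.1)
       + eps^-1 * (K (w'.1 + t *: d) - K w.1 - (p + t * q))).
  by rewrite ler_pM2l//; lra.
by rewrite !mulrDr !mulVKf ?gt_eqF//; lra.
Qed.

Lemma K_bregman_ge x y : U x -> U y ->
  beta / 2 * dotv (x - y) (x - y) <= bregman K x y.
Proof.
apply: bregman_ge => // {}x {}y t Ux Uy t01.
by rewrite -enorm_sqr; exact: (K_strong.2).
Qed.

Lemma step_dom i w w' x : Jdom x -> Jdom w.1 ->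
  RPDC_step U_ J_ G A b K gamma eps rho i w w' -> Jdom w'.1.
Proof.
move=> dx dw hw j; have [_ fi _] := step_min dx hw.
have [->//|ji] := eqVneq j i; case: hw => _ /(_ _ ji) e _.
by rewrite /Jfin e; exact: dw.
Qed.

(** Test each variational inequality at the other solution and add: strong monotonicity of [grad K]
    leaves [beta |w1.1 - w2.1|^2 <= 0]. Uniqueness makes the iterates functions of the drawn
    indices. *)
Lemma step_unique i w w1 w2 x : Jdom x ->
  RPDC_step U_ J_ G A b K gamma eps rho i w w1 ->
  RPDC_step U_ J_ G A b K gamma eps rho i w w2 -> w1 = w2.
Proof.
move=> dx s1 s2.
have [U1 f1 _] := step_min dx s1; have [U2 f2 _] := step_min dx s2.
have := variational_inequality dx s1 U2 f2.
have := variational_inequality dx s2 U1 f1.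
have := K_bregman_ge U1 U2; have := K_bregman_ge U2 U1.
have e : w1.1 = w2.1 -> w1 = w2.
  case: s1 s2 => _ _ e1 [_ _ e2] e; apply/eqP; rewrite -pair_eqE /=.
  by rewrite e eqxx /= e1 e2 e.
rewrite /bregman -(opprB w1.1 w2.1).
move: (grad K w1.1) (grad K w2.1) (grad K w.1) (step_grad w) => g1 g2 g0 g.
set d := w1.1 - w2.1.
rewrite !bdotvBr (_ : bdotv i g (- d) = - bdotv i g d); last first.
  by rewrite -scaleN1r bdotvZr mulN1r.
rewrite !(dotvNl, dotvNr, dotvBl g1 g0, dotvBl g2 g0) => h1 h2 h3 h4.
have dd : beta * dotv d d <= 0.
  have -> : beta * dotv d d = beta / 2 * dotv d d + beta / 2 * dotv d d by field.
  move: h1 h2 h3 h4; rewrite !bdotvBr; lra.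
apply: e; apply/eqP; rewrite -subr_eq0; apply/eqP; apply: dotv_eq0.
by apply/eqP; rewrite eq_le dotv_ge0 andbT -(pmulr_rle0 _ K_strong.1).
Qed.

Definition Lr u (p : 'cV[R]_m) : R := G u + \sum_i Jr i u + dotv p (A *m u - b).

Lemma lagrangianE u p : Jdom u -> lagrangian G J A b u p = (Lr u p)%:E.
Proof. by move=> du; rewrite /lagrangian (sepJE du). Qed.

Definition phir (w ws : V * 'cV[R]_m) : R :=
  bregman K ws.1 w.1 + eps / (2 * N%:R * rho) * dotv (w.2 - ws.2) (w.2 - ws.2)
  + eps * (N%:R - 1) / N%:R * (Lr w.1 w.2 - Lr ws.1 ws.2)
  + eps * (N%:R - 2) * gamma / (2 * N%:R) * dotv (A *m w.1 - b) (A *m w.1 - b)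
  + eps / N%:R * (Lr w.1 ws.2 - Lr ws.1 ws.2).

Lemma phiE w ws : Jdom w.1 -> Jdom ws.1 ->
  phi N G J A b K gamma eps rho w ws = (phir w ws)%:E.
Proof.
move=> dw ds; rewrite /phi /Lambda !lagrangianE// !enorm_sqr; by [].
Qed.

(** The last term of [phi] is [+oo] because its weight [eps / N] is positive, and no other term is
    [-oo]. *)
Lemma phi_pinfty w ws : (0 < N)%N -> ~ Jdom w.1 -> Jdom ws.1 ->
  phi N G J A b K gamma eps rho w ws = +oo%E.
Proof.
move=> N0 dw ds; rewrite /phi /Lambda !(lagrangianE _ ds).
have N0R : (0 : R) < N%:R by rewrite ltr0n.
have Loo p : lagrangian G J A b w.1 p = +oo%E.
  by rewrite /lagrangian (sepJ_pinfty dw).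
have c0 : (0 <= eps * (N%:R - 1) / N%:R)%R.
  by rewrite divr_ge0 ?ler0n// mulr_ge0 ?(ltW eps_gt0)// subr_ge0 ler1n.
rewrite !Loo -!EFinN !addye// [X in (_ + X)%E]gt0_muley ?lte_fin ?divr_gt0//.
rewrite addey// -ltNye.
(* For [N = 1] the weight is 0 and the convention [0 * +oo = 0] applies. *)
move: c0; rewrite le_eqVlt => /orP[/eqP<-|c0].
  by rewrite mul0e ltNyr.
by rewrite gt0_muley ?lte_fin// addey// addye.
Qed.

Variables (BG lam : R) (ws : V * 'cV[R]_m).
Hypothesis N_gt0 : (0 < N)%N.
Hypothesis gamma_ge0 : 0 <= gamma.
Hypothesis rho_gt0 : 0 < rho.
Hypothesis G_descent : forall x y, bregman G x y <= BG / 2 * dotv (x - y) (x - y).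
Hypothesis A_bound : forall x, dotv (A *m x) (A *m x) <= lam * dotv x x.
Hypothesis ws_dom : Jdom ws.1.
Hypothesis ws_feas : A *m ws.1 = b.

(** The gains of one iteration in [|u' - u|^2] and [|A u' - b|^2]; the upper bounds on [eps] and
    [rho] make them positive. *)
Let c1 := beta / 2 - eps * (BG + gamma * lam) / 2.
Let c2 := eps / (2 * N%:R) * (2 * gamma - (2 * N%:R - 1) * rho).

(** The variational inequality at [ws.1], combined with the three-point identity for [bregman K].
    Replacing the linear terms by differences of [G] and of [gamma / 2 |A u - b|^2] costs
    [eps * (BG + gamma * lam) / 2] times [|u' - u|^2], paid for by the strong convexity of [K]. *)
Lemma step_bregman_descent i w w' : Jdom w.1 ->
  RPDC_step U_ J_ G A b K gamma eps rho i w w' ->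
  bregman K ws.1 w'.1 <= bregman K ws.1 w.1
    + eps * (bdotv i (step_grad w) (ws.1 - w.1) + Jr i ws.1 - Jr i w.1)
    - eps * (Lr w'.1 w.2 - Lr w.1 w.2)
    - eps * gamma / 2 * (dotv (A *m w'.1 - b) (A *m w'.1 - b)
                         - dotv (A *m w.1 - b) (A *m w.1 - b))
    - c1 * dotv (w'.1 - w.1) (w'.1 - w.1).
Proof.
move=> dw hw; have [Uw' fw' _] := step_min ws_dom hw.
have Uw := Jdom_sub dw; have Us := Jdom_sub ws_dom.
have h1 := variational_inequality ws_dom hw Us (ws_dom i).
have h3 := K_bregman_ge Uw' Uw.
have h6 := G_descent w'.1 w.1.
have h8 := A_bound (w'.1 - w.1).
(* Only block [i] moves, so products with [w'.1 - w.1] and differences of [J] need no restriction to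
   that block. *)
have bsame j : j != i -> submxcol w'.1 j = submxcol w.1 j by case: hw => _ + _; exact.
have h4 : bdotv i (step_grad w) (ws.1 - w'.1) =
    bdotv i (step_grad w) (ws.1 - w.1) - dotv (step_grad w) (w'.1 - w.1).
  rewrite (@dotv_single_block _ _ _ i).
    by rewrite !bdotvBr; ring.
  by move=> j ji; rewrite submxcolB bsame// subrr.
have h5 : \sum_j Jr j w'.1 - \sum_j Jr j w.1 = Jr i w'.1 - Jr i w.1.
  rewrite (bigD1 i)//= [X in _ - X](bigD1 i)//= opprD addrACA -sumrB.
  rewrite [X in _ + X](_ : _ = 0) ?addr0//; apply: big1 => j ji.
  by rewrite /Jr bsame// subrr.
move: h1; rewrite h4 => {h4} h1.
have h7 : dotv (step_grad w) (w'.1 - w.1) = dotv (grad G w.1) (w'.1 - w.1)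
    + dotv w.2 (A *m (w'.1 - w.1))
    + gamma * dotv (A *m w.1 - b) (A *m (w'.1 - w.1)).
  by rewrite /step_grad dotvDl -dotv_mulmx dotvDl dotvZl addrA.
move: h1 h3 h6; rewrite h7 /bregman /Lr.
have -> : ws.1 - w'.1 = (ws.1 - w.1) - (w'.1 - w.1) by rewrite opprB addrA subrK.
have -> : A *m w'.1 - b = (A *m w.1 - b) + A *m (w'.1 - w.1).
  by rewrite mulmxBr addrCA (addrC (A *m w.1)) addrK.
move: h8; set r := A *m w.1 - b; set d := w'.1 - w.1; set Ad := A *m d.
move: (grad K w'.1) (grad K w.1) (grad G w.1) (bdotv _ _ _) => k' k g bd.
rewrite (dotvBl k' k) !(dotvDl r Ad) !(dotvDr _ r Ad) (dotvC Ad r).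
rewrite (dotvBr k' _ d) (dotvBr k _ d).
move=> hA h1 h3 h6.
have eA : eps * (gamma * dotv Ad Ad) <= eps * (gamma * (lam * dotv d d)).
  by rewrite ler_pM2l// ler_wpM2l.
have eG : eps * (G w'.1 - G w.1 - dotv g d) <= eps * (BG / 2 * dotv d d).
  by rewrite ler_pM2l.
have eJ : eps * (\sum_j Jr j w'.1 - \sum_j Jr j w.1) =
    eps * (Jr i w'.1 - Jr i w.1) by rewrite h5.
move: h1 h3 eA eG eJ; rewrite /c1; clear.
move: (\sum_j Jr j w'.1) (\sum_j Jr j w.1) (dotv k' _) (dotv k' _) (dotv k _) (dotv k _).
move: (dotv g d) (dotv d d) (dotv _ Ad) (dotv _ Ad) (dotv r r) (dotv _ Ad).
move: (dotv w.2 r).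
by move=> *; lra.
Qed.

Definition gap u : R := Lr u ws.2 - Lr ws.1 ws.2.

(** Expanding the multiplier update, the cross term [<p - ps, A u' - b>] merges the two Lagrangian
    terms of [phi] at [u'] into [eps * Lr w'.1 w.2], which the previous bound cancels. The remaining
    multiples of [|A u' - b|^2] add up to [- c2]. *)
Lemma step_phir i w w' : Jdom w.1 ->
  RPDC_step U_ J_ G A b K gamma eps rho i w w' ->
  phir w' ws <= phir w ws
    + eps * (bdotv i (step_grad w) (ws.1 - w.1) + Jr i ws.1 - Jr i w.1)
    + eps / N%:R * (Lr w.1 w.2 - Lr ws.1 ws.2)
    + eps * gamma / N%:R * dotv (A *m w.1 - b) (A *m w.1 - b)
    - eps / N%:R * gap w.1
    - c1 * dotv (w'.1 - w.1) (w'.1 - w.1)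
    - c2 * dotv (A *m w'.1 - b) (A *m w'.1 - b).
Proof.
move=> dw hw; have := step_bregman_descent dw hw.
have hp : w'.2 = w.2 + rho *: (A *m w'.1 - b) by case: hw.
have N0 : N%:R != 0 :> R by rewrite pnatr_eq0 -lt0n.
rewrite /phir /gap hp /c2.
move: (bregman K ws.1 w'.1) (bregman K ws.1 w.1) (c1 * _) (bdotv _ _ _) => D' D cD bd.
rewrite (addrAC w.2) /Lr ws_feas subrr dotv0r.
move: (\sum_j Jr j w'.1) (\sum_j Jr j w.1) (\sum_j Jr j ws.1) => S' S Ss.
move: (A *m w'.1 - b) (A *m w.1 - b) => r' r.
have hP : dotv (w.2 - ws.2) r' = dotv w.2 r' - dotv ws.2 r' by rewrite dotvBl.
move: hP; move: (w.2 - ws.2) => P hP.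
rewrite !(dotvDl P) !(dotvDr _ P) !(dotvZl, dotvZr) (dotvC r' P) hP.
rewrite (dotvDl w.2) dotvZl.
rewrite -subr_ge0 => h; rewrite -subr_ge0.
apply: (le_trans h); rewrite le_eqVlt; apply/orP; left; apply/eqP.
by field; rewrite N0 gt_eqF.
Qed.

(** Over all [i] the block products add up to a full one. Convexity of [G] bounds it so as to cancel
    the Lagrangian difference and the residual at [w]. *)
Lemma sum_step_phir w (w_ : 'I_N -> V * 'cV[R]_m) : Jdom w.1 ->
  (forall x y, 0 <= bregman G x y) ->
  (forall i, RPDC_step U_ J_ G A b K gamma eps rho i w (w_ i)) ->
  \sum_i phir (w_ i) ws <= N%:R * phir w ws - eps * gap w.1
    - c1 * (\sum_i dotv ((w_ i).1 - w.1) ((w_ i).1 - w.1))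
    - c2 * (\sum_i dotv (A *m (w_ i).1 - b) (A *m (w_ i).1 - b)).
Proof.
move=> dw G_conv hw.
apply: (le_trans (ler_sum _ (fun i _ => step_phir dw (hw i)))).
have N0 : N%:R != 0 :> R by rewrite pnatr_eq0 -lt0n.
have ha : \sum_i (bdotv i (step_grad w) (ws.1 - w.1) + Jr i ws.1 - Jr i w.1) <=
    - (Lr w.1 w.2 - Lr ws.1 ws.2) - gamma * dotv (A *m w.1 - b) (A *m w.1 - b).
  rewrite !big_split /= sumrN -dotv_blocks /step_grad.
  have hr : A *m (ws.1 - w.1) = - (A *m w.1 - b) by rewrite mulmxBr ws_feas opprB.
  rewrite dotvDl -dotv_mulmx hr dotvNr dotvDl dotvZl.
  have := G_conv ws.1 w.1; rewrite /bregman /Lr ws_feas subrr dotv0r.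
  move: (dotv (grad G _) _) (\sum_j Jr j w.1) (\sum_j Jr j ws.1).
  by move: (dotv _ _) (dotv _ _) => *; lra.
move: (phir w ws) (gap w.1) ha => F g ha.
rewrite !big_split /= !sumrN -!mulr_sumr !sumr_const !card_ord.
have cancel (a x : R) : a / N%:R * (x *+ N) = a * x by rewrite -mulr_natl; field.
rewrite -(mulr_natl F N) !cancel; move: ha; rewrite -(ler_pM2l eps_gt0).
move=> *; lra.
Qed.

(** * Error bound from metric subregularity *)

Variables (B c : R).
Hypothesis G_lip : grad_lipschitz_on setT BG G.
Hypothesis K_lip : grad_lipschitz_on U B K.
Hypothesis c_gt0 : 0 < c.
Hypothesis subregular : forall x : V * 'cV[R]_m,
  ((Defs.edist x ws)%:E <= c%:E * edist_set (0, 0)%R (KKT U G J A b x))%E.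

Let K_bregman_nonneg x y : U x -> U y -> 0 <= bregman K x y.
Proof.
move=> Ux Uy; apply: le_trans (K_bregman_ge Ux Uy).
by rewrite mulr_ge0 ?dotv_ge0// divr_ge0// ltW// K_strong.1.
Qed.

Lemma subregular_sqr (x h : V * 'cV[R]_m) : KKT U G J A b x h ->
  dotv (x.1 - ws.1) (x.1 - ws.1) + dotv (x.2 - ws.2) (x.2 - ws.2) <=
  c ^+ 2 * (dotv h.1 h.1 + dotv h.2 h.2).
Proof.
move=> hK; have : ((Defs.edist x ws)%:E <= (c * Defs.edist (0, 0)%R h)%R%:E)%E.
  apply: (le_trans (subregular x)); rewrite EFinM lee_pmul2l ?lte_fin//.
  by apply: ereal_inf_lbound; exists h.
rewrite lee_fin => h1.
have e0 (y z : V * 'cV[R]_m) : 0 <= Defs.edist y z by exact: sqrtr_ge0.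
have esq (y z : V * 'cV[R]_m) : Defs.edist y z ^+ 2 =
    dotv (y.1 - z.1) (y.1 - z.1) + dotv (y.2 - z.2) (y.2 - z.2).
  by rewrite sqr_sqrtr ?enorm_sqr ?addr_ge0 ?dotv_ge0// sqr_ge0.
have : Defs.edist x ws ^+ 2 <= (c * Defs.edist (0, 0) h) ^+ 2.
  by rewrite ler_pXn2r ?nnegrE// mulr_ge0// ltW.
by rewrite exprMn !esq /= !sub0r !(dotvNl, dotvNr) !opprK.
Qed.

Section ErrorBound.
Variables (w : V * 'cV[R]_m) (w_ : 'I_N -> V * 'cV[R]_m).
Hypothesis w_dom : Jdom w.1.
Hypothesis steps : forall i, RPDC_step U_ J_ G A b K gamma eps rho i w (w_ i).

Let S1 := \sum_i dotv ((w_ i).1 - w.1) ((w_ i).1 - w.1).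
Let S2 := \sum_i dotv (A *m (w_ i).1 - b) (A *m (w_ i).1 - b).

(** Each block carries the update it receives when drawn, so the optimality conditions of all blocks
    meet at one point. *)
Definition all_blocks : V := \mxcol_i submxcol (w_ i).1 i.

Let ubar := all_blocks.
Let q := w.2 + gamma *: (A *m w.1 - b).
Let dK i := grad K (w_ i).1 - grad K w.1.
(** The subgradient read off from the optimality conditions. As [K] need not be separable, each
    block has its own difference [dK i]. *)
Let xi : V := \mxcol_i (- submxcol (step_grad w + eps^-1 *: dK i) i).

Let ubarE i : submxcol ubar i = submxcol (w_ i).1 i.
Proof. by rewrite /ubar /all_blocks mxcolK. Qed.

Lemma all_blocks_dom : Jdom ubar.
Proof. by move=> i; rewrite /Jfin ubarE; have [] := step_min ws_dom (steps i). Qed.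

Lemma all_blocks_subdiff : subdiff J ubar xi.
Proof.
have du := all_blocks_dom; split; first by rewrite sepJE.
move=> y; have [dy|/sepJ_pinfty->] := pselect (Jdom y); last by rewrite leey.
rewrite !sepJE// -EFinD lee_fin dotv_blocks -big_split /=.
apply: ler_sum => i _.
have [Ui _ _] := step_min ws_dom (steps i).
(* The test point differs from [(w_ i).1] in block [i] only, which reduces the [K] term to that
   block. *)
pose v := replace_block i y (w_ i).1.
have vi : submxcol v i = submxcol y i by rewrite submxcol_replace eqxx.
have vj j : j != i -> submxcol (v - (w_ i).1) j = 0.
  by move=> ji; rewrite submxcolB submxcol_replace (negbTE ji) subrr.
have Uv : U v.
  move=> j; rewrite submxcol_replace; case: eqP => [->|_]; last exact: Ui.
  exact: Jfin_sub (dy i).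
have fv : Jfin i v by rewrite /Jfin vi; exact: dy.
have := variational_inequality ws_dom (steps i) Uv fv.
rewrite (dotv_single_block _ vj) -/(dK i).
have bv z : bdotv i z (v - (w_ i).1) = bdotv i z (y - ubar).
  by rewrite /bdotv !submxcolB vi ubarE.
have -> : Jr i v = Jr i y by rewrite /Jr vi.
have <- : Jr i ubar = Jr i (w_ i).1 by rewrite /Jr ubarE.
have -> : bdotv i xi (y - ubar) =
    - (bdotv i (step_grad w) (y - ubar) + eps^-1 * bdotv i (dK i) (y - ubar)).
  by rewrite -bdotvZl -bdotvDl /bdotv /xi mxcolK dotvNl.
rewrite !bv; set s := bdotv i (step_grad w) _; set t := bdotv i (dK i) _.
have e1 : eps * eps^-1 = 1 by rewrite divff ?gt_eqF.
rewrite -(ler_pM2l eps_gt0).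
have -> : eps * (Jr i ubar + - (s + eps^-1 * t)) = eps * (Jr i ubar - s) - eps * eps^-1 * t.
  by ring.
by rewrite e1; lra.
Qed.

Let h1 := grad G ubar + xi + A^T *m q.
Let h2 := b - A *m ubar.

Lemma all_blocks_KKT : KKT U G J A b (ubar, q) (h1, h2).
Proof.
(* [J] is [+oo] off [U], so [xi] already accounts for the constraint and the normal vector can be
   0. *)
split=> //; exists xi, 0; split=> /=; first exact: all_blocks_subdiff.
  by split=> [|z _]; [exact: (Jdom_sub all_blocks_dom)|rewrite dotv0l].
by rewrite addr0.
Qed.

Let S1_ge i : dotv ((w_ i).1 - w.1) ((w_ i).1 - w.1) <= S1.
Proof.
rewrite /S1 [leRHS](bigD1 i)//= lerDl; apply: sumr_ge0 => j _; exact: dotv_ge0.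
Qed.

Let S2_ge i : dotv (A *m (w_ i).1 - b) (A *m (w_ i).1 - b) <= S2.
Proof.
rewrite /S2 [leRHS](bigD1 i)//= lerDl; apply: sumr_ge0 => j _; exact: dotv_ge0.
Qed.

Let S1_ge0 : 0 <= S1.
Proof. by apply: sumr_ge0 => i _; exact: dotv_ge0. Qed.

Let du_le : dotv (ubar - w.1) (ubar - w.1) <= S1.
Proof.
rewrite dotv_blocks; apply: ler_sum => i _; apply: le_trans (bdotv_le i _).
by rewrite /bdotv !submxcolB ubarE.
Qed.

(** The absolute value allows [S1] to be bounded above without a sign for [lam]. *)
Let A_abs x : dotv (A *m x) (A *m x) <= `|lam| * dotv x x.
Proof.
by apply: (le_trans (A_bound x)); rewrite ler_wpM2r ?dotv_ge0// ler_norm.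
Qed.

Lemma residual_le : dotv (A *m w.1 - b) (A *m w.1 - b) <= 2 * S2 + 2 * `|lam| * S1.
Proof.
pose i := Ordinal N_gt0.
have -> : A *m w.1 - b = (A *m (w_ i).1 - b) + A *m (w.1 - (w_ i).1).
  by rewrite mulmxBr addrCA (addrC (A *m (w_ i).1)) addrK.
apply: (le_trans (dotv_sqrD _ _)); rewrite -mulrA -!mulrDr ler_pM2l//.
apply: lerD; first exact: S2_ge.
apply: (le_trans (A_abs _)); rewrite ler_wpM2l//.
by rewrite -opprB dotvNl dotvNr opprK; exact: S1_ge.
Qed.

Lemma dual_residual_le : dotv h2 h2 <= 4 * S2 + 6 * `|lam| * S1.
Proof.
have -> : h2 = - (A *m w.1 - b) + - (A *m (ubar - w.1)).
  by rewrite mulmxBr !opprB addrA subrK.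
apply: (le_trans (dotv_sqrD _ _)); rewrite !(dotvNl, dotvNr) !opprK.
have := residual_le; have := A_abs (ubar - w.1).
have : `|lam| * dotv (ubar - w.1) (ubar - w.1) <= `|lam| * S1 by rewrite ler_wpM2l.
by lra.
Qed.

(** The choice of [q] makes [A^T *m q] cancel against [step_grad w]; only differences of [grad G]
    and [grad K] remain, which are Lipschitz. *)
Lemma primal_residual_le :
  dotv h1 h1 <= 2 * (BG ^+ 2 + eps ^- 2 * B ^+ 2) * S1.
Proof.
pose gG := grad G ubar - grad G w.1.
have hb i : bdotv i h1 h1 <= 2 * bdotv i gG gG + 2 * (eps ^- 2 * (B ^+ 2 *
    dotv ((w_ i).1 - w.1) ((w_ i).1 - w.1))).
  have e : submxcol h1 i = submxcol gG i + submxcol (- (eps^-1 *: dK i)) i.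
    rewrite /h1 (submxcolD (_ + xi)) (submxcolD _ xi) mxcolK /step_grad -/q /gG.
    move: (grad G ubar) (grad G w.1) (A^T *m q) (eps^-1 *: dK i) => g1 g2 a k.
    by apply/matrixP => j l; rewrite !mxE; ring.
  rewrite {1}/bdotv e; apply: (le_trans (dotv_sqrD _ _)); rewrite lerD2l ler_pM2l//.
  rewrite submxcolN submxcolZ !(dotvNl, dotvNr, dotvZl, dotvZr) mulrN opprK.
  rewrite mulrA -invfM -expr2.
  rewrite ler_wpM2l ?invr_ge0 ?sqr_ge0//.
  have [Ui _ _] := step_min ws_dom (steps i).
  apply: le_trans (grad_lipschitz_sqr K_lip Ui (Jdom_sub w_dom)).
  exact: bdotv_le.
rewrite dotv_blocks; apply: (le_trans (ler_sum _ (fun i _ => hb i))).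
rewrite big_split /= -!mulr_sumr -dotv_blocks -/S1.
have : dotv gG gG <= BG ^+ 2 * S1.
  apply: (le_trans (grad_lipschitz_sqr G_lip _ _)) => //.
  by rewrite ler_wpM2l ?sqr_ge0.
by move: (eps ^- 2) => *; lra.
Qed.

(** Go from [w] to [ws] through [(ubar, q)]: subregularity bounds the second leg, while the first
    consists of [w.1 - ubar] and [- gamma *: (A *m w.1 - b)]. *)
Lemma distance_le :
  dotv (w.1 - ws.1) (w.1 - ws.1) + dotv (w.2 - ws.2) (w.2 - ws.2) <=
  2 * (c ^+ 2 * (2 * (BG ^+ 2 + eps ^- 2 * B ^+ 2) * S1 + (4 * S2 + 6 * `|lam| * S1)))
  + 2 * S1 + 2 * gamma ^+ 2 * (2 * S2 + 2 * `|lam| * S1).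
Proof.
have := subregular_sqr all_blocks_KKT => /=.
have : c ^+ 2 * (dotv h1 h1 + dotv h2 h2) <=
   c ^+ 2 * (2 * (BG ^+ 2 + eps ^- 2 * B ^+ 2) * S1 + (4 * S2 + 6 * `|lam| * S1)).
  by rewrite ler_wpM2l ?sqr_ge0// lerD ?primal_residual_le ?dual_residual_le.
have := dotv_sqrD (ubar - ws.1) (w.1 - ubar).
have := dotv_sqrD (q - ws.2) (w.2 - q).
have -> : q - ws.2 + (w.2 - q) = w.2 - ws.2 by rewrite addrC addrA subrK.
have -> : ubar - ws.1 + (w.1 - ubar) = w.1 - ws.1 by rewrite addrC addrA subrK.
have -> : dotv (w.2 - q) (w.2 - q) =
    gamma ^+ 2 * dotv (A *m w.1 - b) (A *m w.1 - b).
  rewrite /q opprD addrA subrr sub0r dotvNl dotvNr opprK dotvZl dotvZr.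
  by rewrite expr2 mulrA.
have : gamma ^+ 2 * dotv (A *m w.1 - b) (A *m w.1 - b) <=
    gamma ^+ 2 * (2 * S2 + 2 * `|lam| * S1) by rewrite ler_wpM2l ?sqr_ge0// residual_le.
have := du_le; rewrite -[in dotv (w.1 - ubar) _]opprB dotvNl dotvNr opprK.
move=> *; lra.
Qed.

End ErrorBound.

(** * Contraction in mean over one iteration *)

Hypothesis ws_saddle : saddle_point U (lagrangian G J A b) ws.
Hypothesis G_conv : forall x y, 0 <= bregman G x y.

Lemma gap_ge0 u : Jdom u -> 0 <= gap u.
Proof.
move=> du; have [_ /(_ u ws.2 (Jdom_sub du)) [_]] := ws_saddle.
by rewrite !lagrangianE// lee_fin /gap subr_ge0.
Qed.

(** The coefficient of [gap] is the [eps] that [sum_step_phir] subtracts: the two Lagrangian weights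
    of [phi] add up to it. *)
Lemma phir_le : exists2 C, 0 <= C &
  forall (w : V * 'cV[R]_m) (w_ : 'I_N -> V * 'cV[R]_m), Jdom w.1 ->
  (forall i, RPDC_step U_ J_ G A b K gamma eps rho i w (w_ i)) ->
  phir w ws <= eps * gap w.1
    + C * (\sum_i dotv ((w_ i).1 - w.1) ((w_ i).1 - w.1)
           + \sum_i dotv (A *m (w_ i).1 - b) (A *m (w_ i).1 - b)).
Proof.
pose C2 := 2 + 2 * `|lam|.
pose D1 := 2 * (BG ^+ 2 + eps ^- 2 * B ^+ 2).
pose C1 := 2 * (c ^+ 2 * (D1 + (4 + 6 * `|lam|))) + 2 + 2 * gamma ^+ 2 * C2.
have N0 : 0 < N%:R :> R by rewrite ltr0n.
pose kp := eps / (2 * N%:R * rho).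
pose kl := eps * (N%:R - 1) / N%:R.
pose kr := eps * (N%:R - 2) * gamma / (2 * N%:R).
have kp0 : 0 <= kp by rewrite divr_ge0 ?mulr_ge0// ltW.
have kl0 : 0 <= kl.
  by rewrite divr_ge0 ?(ltW N0)// mulr_ge0 ?(ltW eps_gt0)// subr_ge0 ler1n.
have lam0 : 0 <= `|lam| by exact: normr_ge0.
have C20 : 0 <= C2 by rewrite /C2; lra.
have D10 : 0 <= D1.
  by rewrite mulr_ge0// addr_ge0 ?sqr_ge0// mulr_ge0 ?invr_ge0 ?sqr_ge0.
have gC0 : 0 <= gamma ^+ 2 * C2 by rewrite mulr_ge0 ?sqr_ge0.
have cD0 : 0 <= c ^+ 2 * (D1 + (4 + 6 * `|lam|)) by rewrite mulr_ge0 ?sqr_ge0//; lra.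
have C10 : 0 <= C1 by rewrite /C1; lra.
(* One summand each for the Bregman, dual, Lagrangian and residual terms. No sign of [B] is given,
   and [kr] may be negative when [N = 1]. *)
exists (`|B| * C1 + kp * C1 + kl / 2 * (C1 + C2) + `|kr| * C2).
  have kl2 : 0 <= kl / 2 by rewrite divr_ge0.
  apply: addr_ge0 (mulr_ge0 (normr_ge0 _) C20).
  apply: addr_ge0 (mulr_ge0 kl2 (addr_ge0 C10 C20)).
  exact: addr_ge0 (mulr_ge0 (normr_ge0 _) C10) (mulr_ge0 kp0 C10).
move=> w w_ dw steps.
have := distance_le dw steps; have := residual_le w w_.
set S1 := \sum_i dotv (_ - w.1) _; set S2 := \sum_i dotv (_ - b) _.
have S10 : 0 <= S1 by apply: sumr_ge0 => i _; exact: dotv_ge0.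
have S20 : 0 <= S2 by apply: sumr_ge0 => i _; exact: dotv_ge0.
set X := S1 + S2.
have X1 : S1 <= X by rewrite /X; lra.
have X2 : S2 <= X by rewrite /X; lra.
have X0 : 0 <= X by rewrite addr_ge0.
set Rr := dotv (A *m w.1 - b) _; set U2 := dotv (w.1 - _) _; set P2 := dotv (w.2 - _) _.
move=> hR hQ.
have U20 : 0 <= U2 by exact: dotv_ge0.
have P20 : 0 <= P2 by exact: dotv_ge0.
have Rr0 : 0 <= Rr by exact: dotv_ge0.
have hlS : `|lam| * S1 <= `|lam| * X by rewrite ler_wpM2l.
have hRX : 2 * S2 + 2 * `|lam| * S1 <= C2 * X by rewrite /C2; lra.
have {}hR : Rr <= C2 * X by lra.
have {}hQ : U2 + P2 <= C1 * X.
  apply: (le_trans hQ).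
  have h1 : gamma ^+ 2 * (2 * S2 + 2 * `|lam| * S1) <= gamma ^+ 2 * (C2 * X).
    by rewrite ler_wpM2l ?sqr_ge0.
  have h2 : D1 * S1 <= D1 * X by rewrite ler_wpM2l.
  have h3 : c ^+ 2 * (D1 * S1 + (4 * S2 + 6 * `|lam| * S1)) <=
      c ^+ 2 * ((D1 + (4 + 6 * `|lam|)) * X) by rewrite ler_wpM2l ?sqr_ge0//; lra.
  by rewrite /C1 -/D1; lra.
have hD : bregman K ws.1 w.1 <= `|B| * (C1 * X).
  apply: (@le_trans _ _ (B * U2)).
    have Us := Jdom_sub ws_dom; have Uw := Jdom_sub dw.
    have := grad_lipschitz_bregman K_lip Us Uw (K_bregman_nonneg Uw Us).
    by rewrite /U2 -(opprB w.1) dotvNl dotvNr opprK.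
  apply: (@le_trans _ _ (`|B| * U2)); first by rewrite ler_wpM2r// ler_norm.
  by rewrite ler_wpM2l//; lra.
(* The difference exceeds [gap w.1] by [<p - ps, A u - b>], to which Young's inequality applies. *)
have hl : Lr w.1 w.2 - Lr ws.1 ws.2 <= gap w.1 + (C1 + C2) * X / 2.
  have := dotv_ge0 ((w.2 - ws.2) - (A *m w.1 - b)).
  have e : Lr w.1 w.2 = Lr w.1 ws.2 + dotv (w.2 - ws.2) (A *m w.1 - b).
    by rewrite /Lr dotvBl; ring.
  rewrite /gap e; move: (A *m w.1 - b) (w.2 - ws.2) @Rr @P2 hR hQ {P20 Rr0 e} => r p Rr P2 hR hQ.
  by rewrite !(dotvBl p r) !(dotvBr _ p r) (dotvC r p) -/Rr -/P2; lra.
have hkl : kl * (Lr w.1 w.2 - Lr ws.1 ws.2) <= kl * (gap w.1 + (C1 + C2) * X / 2).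
  by rewrite ler_wpM2l.
have hkp : kp * P2 <= kp * (C1 * X) by rewrite ler_wpM2l//; lra.
have hkr : kr * Rr <= `|kr| * (C2 * X).
  apply: (@le_trans _ _ (`|kr| * Rr)); first by rewrite ler_wpM2r// ler_norm.
  by rewrite ler_wpM2l.
have hN : eps * gap w.1 = kl * gap w.1 + eps / N%:R * gap w.1.
  by rewrite /kl; field; rewrite gt_eqF.
by rewrite /phir -/(gap w.1) -/kp -/kl -/kr -/P2 -/Rr hN; lra.
Qed.

Hypothesis c1_gt0 : 0 < c1.
Hypothesis c2_gt0 : 0 < c2.

(** The amount subtracted by [sum_step_phir] is at least [th * phir w ws], because [th < 1] and
    [th * M = c0]. *)
Lemma mean_contraction : exists2 alpha, 0 < alpha < 1 &
  forall (w : V * 'cV[R]_m) (w_ : 'I_N -> V * 'cV[R]_m), Jdom w.1 ->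
  (forall i, RPDC_step U_ J_ G A b K gamma eps rho i w (w_ i)) ->
  \sum_i phir (w_ i) ws <= N%:R * (alpha * phir w ws).
Proof.
have [C C0 hC] := phir_le.
have N0 : 0 < N%:R :> R by rewrite ltr0n.
have N1 : 1 <= N%:R :> R by rewrite ler1n.
(* The second [c0] in [M] keeps [th] strictly below 1 even if [C = 0], so the rate stays positive
   for [N = 1]. *)
pose c0 := Num.min c1 c2; pose M := C + c0 + c0.
have c00 : 0 < c0 by rewrite lt_min c1_gt0.
have M0 : 0 < M by rewrite /M; lra.
pose th := c0 / M.
have th0 : 0 < th by rewrite divr_gt0.
have th1 : th < 1 by rewrite ltr_pdivrMr// mul1r /M; lra.
exists (1 - th / N%:R).
  have : 0 < th / N%:R by rewrite divr_gt0.
  have : th / N%:R < 1 by rewrite ltr_pdivrMr// mul1r (lt_le_trans th1).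
  by lra.
move=> w w_ dw steps; apply: (le_trans (sum_step_phir dw G_conv steps)).
have := hC _ _ dw steps; have := gap_ge0 dw.
have : 0 <= \sum_i dotv ((w_ i).1 - w.1) ((w_ i).1 - w.1).
  by apply: sumr_ge0 => i _; exact: dotv_ge0.
have : 0 <= \sum_i dotv (A *m (w_ i).1 - b) (A *m (w_ i).1 - b).
  by apply: sumr_ge0 => i _; exact: dotv_ge0.
set S1 := \sum_i dotv (_ - w.1) _; set S2 := \sum_i dotv (_ - b) _.
move=> S20 S10 g0 hp.
have e : N%:R * ((1 - th / N%:R) * phir w ws) = N%:R * phir w ws - th * phir w ws.
  by field; rewrite gt_eqF.
have h1 : c0 * S1 <= c1 * S1 by rewrite ler_wpM2r// ge_min lexx.
have h2 : c0 * S2 <= c2 * S2 by rewrite ler_wpM2r// ge_min lexx orbT.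
have X0 : 0 <= S1 + S2 by rewrite addr_ge0.
have h3 : th * phir w ws <= th * (eps * gap w.1 + M * (S1 + S2)).
  rewrite ler_pM2l//; apply: (le_trans hp); rewrite lerD2l ler_wpM2r// /M; lra.
have h4 : th * (eps * gap w.1) <= eps * gap w.1.
  by rewrite ler_piMl ?mulr_ge0 ?(ltW eps_gt0)// ltW.
have h5 : th * (M * (S1 + S2)) = c0 * S1 + c0 * S2.
  by rewrite mulrA /th divfK ?gt_eqF// mulrDr.
rewrite e; move: h3; rewrite (mulrDr th (eps * gap w.1)) h5; lra.
Qed.

End Method.

(** * Expectation over the drawn indices *)

Section RandomIndices.
Context {R : realType} {d : measure_display} {Omega : measurableType d}.
Context (P : probability Omega R) {N : nat} (i_ : nat -> Omega -> 'I_N).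
Hypothesis N_gt0 : (0 < N)%N.
Hypothesis i_unif : uniform_indices P i_.
Hypothesis i_indep : independent_indices P i_.

Definition cylinder (s : seq 'I_N) : set Omega :=
  \bigcap_(t in [set` iota 0 (size s)])
    (i_ t @^-1` [set nth (Ordinal N_gt0) s t]).

Lemma cylinderE s omega :
  cylinder s omega <->
  forall t, (t < size s)%N -> i_ t omega = nth (Ordinal N_gt0) s t.
Proof.
split=> h t => [ts|/= ts]; apply: h; rewrite /= ?mem_iota//.
by move: ts; rewrite mem_iota.
Qed.

Lemma cylinder_nil : cylinder [::] = setT.
Proof. by apply/seteqP; split=> // omega _; apply/cylinderE. Qed.

Lemma cylinder_rcons s i omega :
  cylinder (rcons s i) omega <-> cylinder s omega /\ i_ (size s) omega = i.
Proof.
rewrite !cylinderE size_rcons; split=> [h|[h hi] t].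
  split=> [t ts|]; rewrite h ?nth_rcons ?ts ?ltnn ?eqxx//.
  exact: ltnW.
rewrite ltnS leq_eqVlt nth_rcons => /orP[/eqP->|ts].
  by rewrite ltnn eqxx.
by rewrite ts h.
Qed.

Lemma measurable_cylinder s : measurable (cylinder s).
Proof.
by apply: bigcap_measurableType => t _; exact: (i_unif t _).1.
Qed.

Lemma probability_cylinder s : P (cylinder s) = (N%:R^-1 ^+ size s)%:E.
Proof.
rewrite /cylinder (i_indep (fun t => [set nth (Ordinal N_gt0) s t])) ?iota_uniq//.
rewrite (eq_bigr (fun=> (N%:R^-1)%:E)); last by move=> t _; exact: (i_unif t _).2.
by rewrite prodEFin big_const_seq count_predT size_iota iter_mulr_1.
Qed.

(** Its probability is positive. A representative outcome can thus be chosen for every finite index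
    sequence. *)
Lemma cylinder_nonempty s : cylinder s !=set0.
Proof.
apply/set0P/eqP => e; have := probability_cylinder s.
rewrite e measure0 => -[] /eqP; rewrite eq_sym expf_eq0 invr_eq0 pnatr_eq0.
by rewrite (gtn_eqF N_gt0) andbF.
Qed.

Section Process.
Context {S : Type} (w : nat -> Omega -> S) (w0 : S).
Context (step : 'I_N -> S -> S -> Prop) (D : set S) (f : S -> R) (alpha : R).
Hypothesis w_init : forall omega, w 0%N omega = w0.
Hypothesis w_step : forall k omega, step (i_ k omega) (w k omega) (w k.+1 omega).
Hypothesis D_init : D w0.
Hypothesis D_step : forall i x y, D x -> step i x y -> D y.
Hypothesis step_inj : forall i x y z, D x -> step i x y -> step i x z -> y = z.
Hypothesis alpha_ge0 : 0 <= alpha.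
Hypothesis f_step : forall x y, D x -> (forall i, step i x (y i)) ->
  \sum_i f (y i) <= N%:R * (alpha * f x).

Lemma process_inv k omega : D (w k omega).
Proof.
elim: k => [|k IH]; first by rewrite w_init.
exact: D_step IH (w_step k omega).
Qed.

Lemma process_cylinder s omega omega' : cylinder s omega -> cylinder s omega' ->
  w (size s) omega = w (size s) omega'.
Proof.
elim/last_ind: s => [|s i IH]; first by rewrite !w_init.
move=> /cylinder_rcons[cs e] /cylinder_rcons[cs' e'].
have ew := IH cs cs'; have := w_step (size s) omega; have := w_step (size s) omega'.
rewrite e e' -ew size_rcons => h' h.
exact: step_inj (process_inv _ _) h h'.
Qed.

Variable rep : seq 'I_N -> Omega.
Hypothesis repP : forall s, cylinder s (rep s).

Let val s : R := f (w (size s) (rep s)).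

(** The representatives of the sequences [rcons s i] are different outcomes, yet all reach the same
    state at time [size s], so [f_step] applies to their successors. *)
Lemma sum_children s : \sum_i val (rcons s i) <= N%:R * (alpha * val s).
Proof.
apply: f_step => [|i]; first exact: process_inv.
rewrite size_rcons.
have /cylinder_rcons[cs e] := @repP (rcons s i).
rewrite -(process_cylinder cs (@repP s)); have := w_step (size s) (rep (rcons s i)).
by rewrite e.
Qed.

(* f (w (size s + k)) times the indicator of the cylinder of s, as a sum over
   the extensions of s by k further indices *)
Fixpoint simple k s omega : \bar R :=
  if k is k'.+1 then (\sum_i simple k' (rcons s i) omega)%E
  else ((val s)%:E * (\1_(cylinder s) omega)%:E)%E.

Lemma simple0 k s omega : ~ cylinder s omega -> simple k s omega = 0%E.
Proof.
elim: k s => [|k IH] s ns /=; first by rewrite indicE memNset// mule0.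
by rewrite big1// => i _; apply: IH => /cylinder_rcons[].
Qed.

Lemma simpleE k s omega : cylinder s omega ->
  simple k s omega = (f (w (size s + k) omega))%:E.
Proof.
elim: k s => [|k IH] s cs /=.
  by rewrite indicE mem_set// mule1 addn0 /val (process_cylinder (@repP s) cs).
rewrite (bigD1 (i_ (size s) omega))//= big1 ?adde0 => [|i ni].
  by rewrite IH ?size_rcons ?addSnnS//; apply/cylinder_rcons.
apply: simple0 => /cylinder_rcons[_ e]; by rewrite e eqxx in ni.
Qed.

Lemma integrable_simple k s : P.-integrable setT (simple k s).
Proof.
elim: k s => [|k IH] s; last by apply: integrable_sum => // i _; exact: IH.
by apply: integrableZl => //; apply: integrable_indic => //; exact: measurable_cylinder.
Qed.

(** Induction on [k] for all [s]: the factor [N^-1] from a longer cylinder cancels the [N] of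
    [sum_children]. *)
Lemma integral_simple_le k s :
  (\int[P]_omega simple k s omega <=
   (N%:R^-1 ^+ size s * (alpha ^+ k * val s))%:E)%E.
Proof.
elim: k s => [|k IH] s /=.
  rewrite integralZl//; last first.
    by apply: integrable_indic => //; exact: measurable_cylinder.
  rewrite integral_indic ?setIT//; last exact: measurable_cylinder.
  by rewrite -[X in (_ * X)%E]/(P (cylinder s)) probability_cylinder -EFinM expr0 mul1r mulrC.
rewrite integral_sum//; last by move=> i; exact: integrable_simple.
apply: (le_trans (lee_sum _ (fun i _ => IH (rcons s i)))).
rewrite sumEFin lee_fin.
under eq_bigr do rewrite size_rcons.
rewrite -!mulr_sumr.
have h := sum_children s.
have N0 : N%:R != 0 :> R by rewrite pnatr_eq0 -lt0n.
have -> : N%:R^-1 ^+ size s * (alpha ^+ k.+1 * val s) =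
    N%:R^-1 ^+ (size s).+1 * (alpha ^+ k * (N%:R * (alpha * val s))).
  by rewrite !exprS; field.
by rewrite ler_wpM2l ?exprn_ge0 ?invr_ge0// ler_wpM2l ?exprn_ge0.
Qed.

End Process.

(** [S] needs no measurable structure, since [f (w k omega)] is a finite combination of indicators
    of cylinders. *)
Lemma expectation_contraction (S : Type) (w : nat -> Omega -> S) (w0 : S)
    (step : 'I_N -> S -> S -> Prop) (D : set S) (f : S -> R) (alpha : R) :
  (forall omega, w 0%N omega = w0) ->
  (forall k omega, step (i_ k omega) (w k omega) (w k.+1 omega)) ->
  D w0 -> (forall i x y, D x -> step i x y -> D y) ->
  (forall i x y z, D x -> step i x y -> step i x z -> y = z) ->
  0 <= alpha ->
  (forall x y, D x -> (forall i, step i x (y i)) ->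
     \sum_i f (y i) <= N%:R * (alpha * f x)) ->
  forall k, (\int[P]_omega (f (w k omega))%:E <= (alpha ^+ k * f w0)%:E)%E.
Proof.
move=> w_init w_step D_init D_step step_inj alpha_ge0 f_step k.
have [rep repP] := choice cylinder_nonempty.
have := integral_simple_le w_init w_step D_init D_step step_inj alpha_ge0 f_step
  repP k [::].
rewrite expr0 mul1r w_init; apply: le_trans; rewrite le_eqVlt; apply/orP; left.
apply/eqP; apply: eq_integral => omega _.
by rewrite (simpleE f w_init w_step D_init D_step step_inj repP)// cylinder_nil.
Qed.

End RandomIndices.

Theorem theorem3 (R : realType) (N m : nat) (n_ : 'I_N -> nat)
  (U_ : forall i, set 'cV[R]_(n_ i))
  (J_ : forall i, 'cV[R]_(n_ i) -> \bar R)
  (G K : 'cV[R]_(\sum_(i < N) n_ i)%N -> R)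
  (A : 'M[R]_(m, (\sum_(i < N) n_ i)%N)) (b : 'cV[R]_m)
  (BG beta B gamma eps rho lam : R)
  (ws : 'cV[R]_(\sum_(i < N) n_ i)%N * 'cV[R]_m)
  (U := prodset U_) (J := sepJ U_ J_)
  (N_gt0 : (0 < N)%N)
  (U_closed : closed U) (U_convex : convex_set U)
  (Ji_proper : forall i x, U_ i x -> (-oo < J_ i x)%E)
  (Ji_convex : forall i, econvex (block_ext U_ J_ (i := i)))
  (J_convex : econvex J) (J_lsc : lower_semicontinuous J)
  (J_dom : edom J `&` U !=set0)
  (G_convex : convex_function setT G)
  (G_diff : differentiable_on setT G)
  (G_lip : grad_lipschitz_on setT BG G)
  (K_strong : strongly_convex_on U beta K)
  (K_diff : differentiable_on U K)
  (K_lip : grad_lipschitz_on U B K)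
  (lam_max : largest_eigenvalue (A^T *m A) lam)
  (eps_bounds : 0 < eps < beta / (BG + gamma * lam))
  (rho_bounds : 0 < rho < 2 * gamma / (2 * N%:R - 1))
  (ws_saddle : saddle_point U (lagrangian G J A b) ws)
  (H_subregular :
     global_strong_metric_subregular (KKT U G J A b) ws (0, 0)) :
  exists alpha : R, 0 < alpha < 1 /\
    forall (d : measure_display) (Omega : measurableType d)
      (P : probability Omega R) (i_ : nat -> Omega -> 'I_N)
      (w0 : 'cV[R]_(\sum_(i < N) n_ i)%N * 'cV[R]_m)
      (w : nat -> Omega -> 'cV[R]_(\sum_(i < N) n_ i)%N * 'cV[R]_m),
      RPDC_sequence U_ J_ G A b K gamma eps rho P i_ w0 w ->
      forall k : nat,
        (\int[P]_omega phi N G J A b K gamma eps rho (w k.+1 omega) ws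
           <= (alpha ^+ k.+1)%:E * phi N G J A b K gamma eps rho w0 ws)%E.

Proof.
have [N0R beta0] : 0 < N%:R :> R /\ 0 < beta by rewrite ltr0n; case: K_strong.
have /andP[eps0 eps1] := eps_bounds; have /andP[rho0 rho1] := rho_bounds.
have N1 : 1 <= N%:R :> R by rewrite ler1n.
have N2 : 0 < 2 * N%:R - 1 :> R by lra.
(* The intervals containing [rho] and [eps] are nonempty, which forces [gamma] and the denominator
   [BG + gamma * lam] to be positive. *)
have gam0 : 0 < gamma.
  by have := lt_trans rho0 rho1; rewrite pmulr_lgt0 ?invr_gt0// pmulr_rgt0.
have den0 : 0 < BG + gamma * lam.
  by have := lt_trans eps0 eps1; rewrite pmulr_rgt0// invr_gt0.
have A_bound := rayleigh_le lam_max.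
have G_breg x y : 0 <= bregman G x y.
  have := @bregman_ge R _ setT G 0 G_diff _ x y I I; rewrite !mul0r; apply.
  move=> u v t _ _ t01; rewrite !mul0r subr0.
  exact: convex_function_le.
have G_desc := descent_lemma G_breg G_lip.
(* Subregularity includes [0] in the KKT set at [ws], which gives feasibility and finiteness of [J]
   at [ws.1]. *)
have [[xi [zeta [[ws_fin _] _ _]]] /= ws_feas] := H_subregular.1.
have {}ws_feas : A *m ws.1 = b by apply/esym/eqP; rewrite -subr_eq0 -ws_feas.
have [c c0 subreg] := H_subregular.2.
have ws_dom := sepJ_fin_num Ji_proper ws_fin.
have c1_gt0 : 0 < beta / 2 - eps * (BG + gamma * lam) / 2.
  by move: eps1; rewrite ltr_pdivlMr//; lra.
have c2_gt0 : 0 < eps / (2 * N%:R) * (2 * gamma - (2 * N%:R - 1) * rho).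
  apply: mulr_gt0; first by rewrite divr_gt0// mulr_gt0.
  by move: rho1; rewrite ltr_pdivlMr//; lra.
have [alpha /andP[alpha0 alpha1] contr] := mean_contraction Ji_proper Ji_convex
  U_convex K_diff K_strong eps0 N_gt0 (ltW gam0) rho0 G_desc A_bound ws_dom
  ws_feas G_lip K_lip c0 subreg ws_saddle G_breg c1_gt0 c2_gt0.
exists alpha; split=> [|d Omega P i_ w0 w [unif indep Uw0 w_init w_step] k].
  by rewrite alpha0.
(* If [J] is infinite at the initial point, the right-hand side is [+oo], as [alpha] is positive. *)
have [w0_dom|w0_dom] := pselect (Jdom U_ J_ w0.1); last first.
  by rewrite phi_pinfty// gt0_muley ?leey// lte_fin exprn_gt0.
have w_dom : forall i (x y : _ * _), Jdom U_ J_ x.1 ->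
    RPDC_step U_ J_ G A b K gamma eps rho i x y -> Jdom U_ J_ y.1.
  by move=> i x y; exact: (step_dom Ji_proper ws_dom).
rewrite phiE// -EFinM.
under eq_integral => omega _.
  rewrite phiE//; last first.
    exact: (process_inv (D := [set x | Jdom U_ J_ x.1]) w_init w_step).
  over.
apply: (expectation_contraction N_gt0 unif indep (w := w)
  (D := [set x | Jdom U_ J_ x.1]) (f := fun x => phir U_ J_ G K A b gamma eps rho x ws)
  w_init w_step w0_dom w_dom _ (ltW alpha0) _ k.+1).
- move=> i x y z _.
  exact: (step_unique Ji_proper Ji_convex U_convex K_diff K_strong eps0 ws_dom).
- by move=> x y dx hy; exact: contr.
Qed.
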